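(* Let $r$ and $d$ be integers with $4 \leq r \leq d$. Then there exists a connected finite simple graph $G = G_{r,d}$, with edge set $E$, such that its toric ideal $I_G$ satisfies $\operatorname{reg}(\mathbb{K}[E]/I_G) = r$ and $\deg h_{\mathbb{K}[E]/I_G}(x) = d$.
   Context: $\mathbb{K}$ is an algebraically closed field of characteristic zero. For a finite simple graph $G$ with vertex set $V=\{v_1,\dots,v_n\}$ and edge set $E=\{e_1,\dots,e_q\}$, the toric ideal $I_G$ is the kernel of the $\mathbb{K}$-algebra map $\varphi:\mathbb{K}[E]=\mathbb{K}[e_1,\dots,e_q]\to \mathbb{K}[v_1,\dots,v_n]$, $\varphi(e_i)=v_{i_1}v_{i_2}$ where $e_i=\{v_{i_1},v_{i_2}\}$; $\mathbb{K}[E]$ is standard graded. For a homogeneous ideal $I$ of a standard graded polynomial ring $R$, $\operatorname{reg}(R/I)=\max\{j-i : \beta_{i,j}(R/I)\neq 0\}$ is the Castelnuovo–Mumford regularity, and the $h$-polynomial $h_{R/I}(x)\in\mathbb{Z}[x]$ is the polynomial with $HS_{R/I}(x)=\sum_{i\ge 0}\dim_{\mathbb{K}}(R/I)_i x^i = h_{R/I}(x)/(1-x)^{\dim(R/I)}$ and $h_{R/I}(1)\neq 0$, where $\dim$ is Krull dimension. *)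

(* Defs.v *)
From HB Require Import structures.
From mathcomp Require Import all_boot all_order all_algebra.
From mathcomp Require Import mpoly.
Set Implicit Arguments. Unset Strict Implicit. Unset Printing Implicit Defensive.
Import Order.TTheory GRing.Theory Num.Theory.
Local Open Scope ring_scope.

Definition simple_graph (n q : nat) (ends : 'I_q -> 'I_n * 'I_n) : Prop :=
  (forall i, (ends i).1 != (ends i).2) /\
  (forall i j, i != j ->
     [set (ends i).1; (ends i).2] != [set (ends j).1; (ends j).2]).

Definition adj (n q : nat) (ends : 'I_q -> 'I_n * 'I_n) : rel 'I_n :=
  fun u v => [exists i, (ends i == (u, v)) || (ends i == (v, u))].

Definition connected_graph (n q : nat) (ends : 'I_q -> 'I_n * 'I_n) : Prop :=
  (0 < n)%N /\ forall u v : 'I_n, connect (adj ends) u v.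

Definition edge_monomials (K : fieldType) (n q : nat)
  (ends : 'I_q -> 'I_n * 'I_n) : q.-tuple {mpoly K[n]} :=
  [tuple ('X_((ends i).1) * 'X_((ends i).2)) | i < q].

Definition toric_ideal (K : fieldType) (n q : nat)
  (ends : 'I_q -> 'I_n * 'I_n) : pred {mpoly K[q]} :=
  [pred p | p \mPo edge_monomials K ends == 0].

(* Graded Betti numbers via Koszul homology:                           *)
(*   beta_{i,j}(R/I) = dim_K Tor_i^R(R/I, K)_j = dim_K H_i(x; R/I)_j.  *)
(* A Koszul i-chain is a family c : {set 'I_q} -> R supported on      *)
(* i-subsets (c S = coefficient of e_S); R/I is represented modulo I.  *)
(*   d(e_S) = sum_{k in S} (-1)^{#{l in S | l < k}} x_k e_{S\k}.       *)
Definition koszul_d (K : fieldType) (q : nat)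
  (c : {set 'I_q} -> {mpoly K[q]}) (T : {set 'I_q}) : {mpoly K[q]} :=
  \sum_(k < q | k \notin T)
     (-1) ^+ #|[set l in T | (l < k)%N]| * 'X_k * c (k |: T).

(* beta_{i,j}(R/I) <> 0 : there is a homogeneous Koszul cycle of      *)
(* homological degree i and internal degree j (coefficients of degree *)
(* j - i) over R/I which is not a boundary.                            *)
Definition betti_nonzero (K : fieldType) (q : nat) (I : pred {mpoly K[q]})
  (i j : nat) : Prop :=
  (i <= j)%N /\
  exists c : {set 'I_q} -> {mpoly K[q]},
    (forall S : {set 'I_q}, #|S| = i -> c S \is (j - i)%N.-homog) /\
    (forall S : {set 'I_q}, #|S| <> i -> c S = 0) /\
    (forall T : {set 'I_q}, I (koszul_d c T)) /\
    ~ (exists b : {set 'I_q} -> {mpoly K[q]},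
         (forall S : {set 'I_q}, #|S| <> i.+1 -> b S = 0) /\
         (forall S : {set 'I_q}, I (c S - koszul_d b S))).

Definition regularity_is (K : fieldType) (q : nat) (I : pred {mpoly K[q]})
  (r : nat) : Prop :=
  (exists i j, betti_nonzero I i j /\ (j - i)%N = r) /\
  (forall i j, betti_nonzero I i j -> (j - i <= r)%N).

Definition hilbert_fun_is (K : fieldType) (q : nat) (I : pred {mpoly K[q]})
  (m k : nat) : Prop :=
  exists s : 'I_k -> {mpoly K[q]},
    (forall t, s t \is m.-homog) /\
    (forall a : 'I_k -> K, I (\sum_t a t *: s t) -> forall t, a t = 0) /\
    (forall p : {mpoly K[q]}, p \is m.-homog ->
       exists a : 'I_k -> K, I (p - \sum_t a t *: s t)).

(* h is the h-polynomial of R/I: HS_{R/I}(x) = h(x)/(1-x)^D with       *)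
(* h(1) <> 0, i.e. (1-x)^D * HS(x) = h(x) coefficientwise.             *)
Definition h_polynomial_is (K : fieldType) (q : nat) (I : pred {mpoly K[q]})
  (h : {poly int}) : Prop :=
  h.[1] != 0 /\
  exists (D : nat) (HF : nat -> nat),
    (forall m, hilbert_fun_is I m (HF m)) /\
    (forall m : nat,
       h`_m = \sum_(t < D.+1 | (t <= m)%N)
                (-1) ^+ t * ('C(D, t))%:Z * (HF (m - t)%N)%:Z).

(* Main.v *)
(* Two odd cycles through x and y (of total length 2m, m = r - 1) are joined by
   k = d - r + 1 paths x - t_i - y with edges a_i, b_i.  If P and Q denote the
   products of alternate cycle edges, the edge ring is the coordinate ring of
   the Segre embedding of P^1 x P^(k-1) (a_i = x t_i, b_i = y t_i), with the
   cycle edges adjoined, modulo the relations P b_i b_j = Q a_i a_j of degree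
   m + 2 = r + 1; these are minimal generators, so the regularity is at least r.

   Peel off t_k: a_k is regular on the edge ring A_k, and A_k / (a_k) has the
   submodule of multiples of t_k, isomorphic up to a shift by one to
   K[b, cycle edges] / P (b_1, ..., b_k), with quotient A_(k-1), where A_0 is a
   polynomial ring.  This gives the h-polynomial recursively,
   h_k = h_(k-1) + x + ... + x^m + x^(m+1) (1 - x)^(k-1), of degree m + k = d.
   The same filtration, carried out in each multigraded strand of the Koszul
   complex, pairs off all faces S except some whose complementary factor has
   degree at most m + 1 = r, which bounds the regularity from above. *)

Require Import Defs.
From HB Require Import structures.
From mathcomp Require Import all_boot all_order all_algebra.
From mathcomp Require Import mpoly.
From mathcomp Require Import zify ring.
Import Order.TTheory GRing.Theory Num.Theory.
Local Open Scope ring_scope.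

Set Implicit Arguments. Unset Strict Implicit. Unset Printing Implicit Defensive.

(** * Acyclicity of families of finite sets *)

Section Chains.

Variables (R : comNzRingType) (q : nat).
Implicit Types (S T : {set 'I_q}) (c b : {set 'I_q} -> R).
Implicit Types (D : {set 'I_q} -> bool).

(** The bound 4 <= r is the shortest choice of cycles: a triangle and an odd cycle of length 2s + 3,
    with s = r - 4, have total length 2(s + 3) = 2m. The upper bound on the regularity builds no
    resolution. The edge ring has a basis of vertex monomials, so each multigraded Koszul strand has
    at most a line over every face S and is the chain complex of a simplicial complex on the edges.
    Exact sequences of modules become partitions of its faces by ranks monotone under inclusion;
    within a layer, faces are matched by moving one variable between S and its complementary factor,
    and any unmatched face is too large to matter. The obstacle is that a face has as many
    complementary factors as its fibre has monomials. The condition on a_a is therefore stated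
    existentially over the fibre ([dva]); once a_a divides no factor, swaps and flips exclude
    everything else that could enlarge the fibre, and the factor is unique. The lower bound rests on
    the monomial P b_0^2, which occurs in no element of the maximal ideal times I_G. *)

Definition incid (k : 'I_q) T : R := (-1) ^+ #|[set l in T | (l < k)%N]|.

(** The weights let one operator be both the Koszul differential ([x k = 'X_k]) and, with all
    weights 1, the boundary map of a simplicial complex. *)
Definition bdry (x : 'I_q -> R) c T : R :=
  \sum_(k < q | k \notin T) incid k T * x k * c (k |: T).

Lemma incidU (k l : 'I_q) T : k \notin T ->
  incid l (k |: T) = (-1) ^+ (k < l)%N * incid l T.
Proof.
move=> kT; rewrite /incid -exprD; congr (_ ^+ _).
have -> : [set x in k |: T | (x < l)%N] =
          if (k < l)%N then k |: [set x in T | (x < l)%N]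
          else [set x in T | (x < l)%N].
  apply/setP=> x; case: ifP => kl; rewrite !inE; case: eqP => [->|_] //=;
  by rewrite ?kl ?andbF // (negPf kT).
by case: ifP => kl //; rewrite cardsU1 inE (negPf kT).
Qed.

Lemma incidK k T : incid k T * incid k T = 1.
Proof. by rewrite /incid -expr2 sqrr_sign. Qed.

Lemma bdry_ext x c c' T : (forall k, k \notin T -> c (k |: T) = c' (k |: T)) ->
  bdry x c T = bdry x c' T.
Proof. by move=> E; apply: eq_bigr => k kT; rewrite E. Qed.

Lemma bdryB x c c' T :
  bdry x (fun S => c S - c' S) T = bdry x c T - bdry x c' T.
Proof.
by rewrite /bdry -sumrB; apply: eq_bigr => k _; rewrite mulrBr.
Qed.

Lemma bdryD x c c' T :
  bdry x (fun S => c S + c' S) T = bdry x c T + bdry x c' T.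
Proof.
by rewrite /bdry -big_split; apply: eq_bigr => k _; rewrite mulrDr.
Qed.

Lemma bdry_bdry x c T : bdry x (bdry x c) T = 0.
Proof.
pose F (k l : 'I_q) := incid k T * x k * (incid l (k |: T) * x l * c (l |: (k |: T))).
have E1 : bdry x (bdry x c) T =
  \sum_(k | k \notin T) \sum_(l | l \notin T) (if k == l then 0 else F k l).
  apply: eq_bigr => k kT; rewrite /bdry mulr_sumr.
  rewrite [RHS](bigID (fun l => l == k)) /= [X in _ = X + _]big1 ?add0r; last first.
    by move=> l /andP[_ /eqP ->]; rewrite eqxx.
  apply: eq_big => [l|l]; first by rewrite !inE negb_or andbC.
  by rewrite !inE negb_or => /andP[lk _]; rewrite eq_sym (negPf lk).
have FN k l : k \notin T -> l \notin T -> k != l -> F k l = - F l k.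
  move=> kT lT kl; rewrite /F !incidU // setUCA.
  have [klt|lkt|E] := ltngtP k l; rewrite ?expr1 ?expr0; [ring|ring|].
  by rewrite (val_inj E) eqxx in kl.
rewrite E1 pair_big_dep /= (bigID (fun p : 'I_q * 'I_q => (p.1 < p.2)%N)) /=.
rewrite [X in _ + X](reindex_inj (h := fun p : 'I_q * 'I_q => (p.2, p.1))) /=; last first.
  by move=> [a b] [a' b'] /= [-> ->].
rewrite [X in _ + X](bigID (fun p : 'I_q * 'I_q => p.1 == p.2)) /=.
rewrite [X in _ + (X + _)]big1 ?add0r; last first.
  by move=> [k l] /= /andP[_ /eqP->]; rewrite eqxx.
apply/eqP; rewrite addr_eq0; apply/eqP; rewrite -sumrN.
apply: eq_big => [[k l]|[k l]] /=.
  by rewrite -leqNgt ltn_neqAle (inj_eq val_inj);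
    case: (k \in T) (l \in T) (k == l) => [] [] [] /=; rewrite ?andbF ?andbT.
move=> /andP[/andP[kT lT] kl].
have ne : k != l by rewrite neq_ltn kl.
by rewrite (negPf ne) eq_sym (negPf ne) FN.
Qed.

(** This makes the boundary truncated to [D] square to zero: both faces between T and its extension
    by k and l are present, so their terms cancel. *)
Definition convex D :=
  forall T (k l : 'I_q), D T -> D (l |: (k |: T)) -> D (k |: T).

Definition chain D (i : nat) c := forall S, ~~ (D S && (#|S| == i)) -> c S = 0.

(** The index is the cardinality of the faces, one more than their dimension, so as to agree with
    the homological degree of the Koszul complex. *)
Definition exact_at D (i : nat) :=
  forall c, chain D i c -> (forall T, D T -> bdry (fun=> 1) c T = 0) ->
  exists2 b, chain D i.+1 b & forall T, D T -> c T = bdry (fun=> 1) b T.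

Lemma exact_ext D D' i : D =1 D' -> exact_at D i -> exact_at D' i.
Proof.
move=> E ex c cc cy.
case: (ex c) => [S|T DT|b cb Eb].
- by rewrite E; apply: cc.
- by apply: cy; rewrite -E.
by exists b => [S|T]; rewrite -E; [apply: cb|apply: Eb].
Qed.

(** Inside [D], the family [D1] is closed under subfaces, so it spans a subcomplex whose quotient is
    spanned by the rest. A cycle bounds in the quotient; subtracting that boundary leaves a cycle of
    the subcomplex. *)
Lemma exact_split D D1 i : convex D ->
  (forall T k, D T -> D (k |: T) -> D1 (k |: T) -> D1 T) ->
  exact_at (fun S => D S && D1 S) i -> exact_at (fun S => D S && ~~ D1 S) i ->
  exact_at D i.
Proof.
move=> cD sub ex1 ex2 c cc cy.
pose c2 S := if D1 S then 0 else c S.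
case: (ex2 c2) => [S|T /andP[DT D1T]|b2 cb2 Eb2].
- rewrite /c2; case: ifP => // D1S; rewrite andbT; exact: cc.
- rewrite -[RHS](cy T DT); apply: bdry_ext => k kT; rewrite /c2.
  case: ifP => // D1k; case Dk: (D (k |: T)); last by rewrite cc // Dk.
  by rewrite (sub T k) in D1T.
pose d2 S := if D S then bdry (fun=> 1) b2 S else 0.
pose c1 S := c S - d2 S.
have d2E T : D T -> bdry (fun=> 1) d2 T = 0.
  move=> DT; rewrite -[RHS](bdry_bdry (fun=> 1) b2 T).
  apply: bdry_ext => k kT; rewrite /d2; case: ifP => // Dk.
  apply/esym/big1 => l lT; rewrite cb2 ?mulr0 //; apply/negP => /andP[/andP[Dl _] _].
  by rewrite (cD T k l) in Dk.
case: (ex1 c1) => [S|T /andP[DT D1T]|b1 cb1 Eb1].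
- rewrite /c1 /d2 => nS; case DS: (D S); last by rewrite cc ?DS // subr0.
  case D1S: (D1 S); last first.
    by rewrite -Eb2 ?DS ?D1S // /c2 D1S subrr.
  rewrite DS D1S /= in nS.
  rewrite cc ?DS // sub0r; apply/eqP; rewrite oppr_eq0; apply/eqP.
  apply: big1 => k kS; rewrite cb2 ?mulr0 //; apply: contra nS => /andP[_].
  by rewrite cardsU1 kS.
- rewrite /c1 bdryB d2E // subr0; exact: cy.
exists (fun S => b1 S + b2 S) => [S|T DT].
  by move=> nS; rewrite cb1 ?cb2 ?addr0 //; apply: contra nS => /andP[/andP[-> _]].
rewrite bdryD; case D1T: (D1 T).
  by rewrite -Eb1 ?DT // /c1 /d2 DT subrK.
rewrite -Eb2 ?DT ?D1T // /c2 D1T [X in X + _]big1 ?add0r // => k kT.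
rewrite cb1 ?mulr0 //; apply/negP => /andP[/andP[Dk D1k] _].
by rewrite (sub T k) in D1T.
Qed.

Lemma convex_ext D D' : D =1 D' -> convex D -> convex D'.
Proof. by move=> E cD T k l; rewrite -!E; apply: cD. Qed.

Lemma convex_level D (rho : {set 'I_q} -> nat) m : convex D ->
  (forall T k, D T -> D (k |: T) -> (rho (k |: T) <= rho T)%N) ->
  convex (fun S => D S && (rho S == m)).
Proof.
move=> cD mono T k l /andP[DT /eqP rT] /andP[Dl /eqP rl].
have Dk := cD T k l DT Dl; rewrite Dk /= eqn_leq -{1}rT -rl.
by rewrite mono //= mono.
Qed.

(* The connecting-homomorphism argument, iterated over a filtration by rank. *)
Lemma exact_rank D (rho : {set 'I_q} -> nat) i : convex D ->
  (forall T k, D T -> D (k |: T) -> (rho (k |: T) <= rho T)%N) ->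
  (forall n, exact_at (fun S => D S && (rho S == n)) i) -> exact_at D i.
Proof.
move=> cD mono ex.
have key n : exact_at (fun S => D S && (rho S < n)%N) i.
  elim: n => [|n IH].
    move=> c cc _; exists (fun=> 0) => // T.
    by rewrite ltn0 andbF.
  have cv : convex (fun S => D S && (rho S < n.+1)%N).
    move=> T k l /andP[DT rT] /andP[Dl rl].
    have Dk := cD T k l DT Dl; rewrite Dk /=.
    by apply: leq_ltn_trans rT; apply: mono.
  apply: (@exact_split _ (fun S => rho S == n)) => //.
  - move=> T k /andP[DT rT] /andP[Dk _] /eqP rk.
    by have := mono T k DT Dk; rewrite rk => h; rewrite eqn_leq h andbT -ltnS.
  - apply: exact_ext (ex n) => S; case: (D S) => //=.
    by case: eqP => [->|_]; rewrite ?ltnSn ?andbF.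
  - apply: exact_ext IH => S; case: (D S) => //=.
    by rewrite ltn_neqAle andbC ltnS.
apply: exact_ext (key (\max_S rho S).+1) => S.
by rewrite ltnS leq_bigmax andbT.
Qed.

(* The element [e] provides a contracting homotopy. *)
Lemma exact_toggle D e i :
  (forall S, e \in S -> D S = D (S :\ e)) -> exact_at D i.
Proof.
move=> tog c cc cy.
exists (fun S => if e \in S then incid e (S :\ e) * c (S :\ e) else 0) => [S|T DT].
  move=> nS; case: ifP => // eS; rewrite cc ?mulr0 //; apply: contra nS.
  by rewrite -tog // => /andP[-> /eqP<-] /=; rewrite (cardsD1 e S) eS.
have [eT|eT] := boolP (e \in T); last first.
  rewrite /bdry (bigD1 e) //= setU11 setU1K // mulr1 mulrA incidK mul1r.
  rewrite big1 ?addr0 // => k /andP[kT ke].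
  by rewrite !inE (negPf eT) eq_sym (negPf ke) mulr0.
have T1 : e \notin T :\ e by rewrite setD11.
(* The cycle condition at T minus e expresses [c T] through the values at the other faces covering T
   minus e; these are the terms of the homotopy. *)
have := cy (T :\ e); rewrite -tog // => /(_ DT).
rewrite /bdry (bigD1 e) //= setD1K // mulr1 => E.
rewrite -[LHS]mul1r -(incidK e (T :\ e)) -mulrA.
have -> : incid e (T :\ e) * c T = - \sum_(k < q | (k \notin T :\ e) && (k != e))
    incid k (T :\ e) * 1 * c (k |: T :\ e).
  by apply/eqP; rewrite -subr_eq0 opprK; apply/eqP.
rewrite -sumrN mulr_sumr; apply: eq_big => [k|k].
  by rewrite !inE; case: eqP => [->|] //=; rewrite ?eT // andbT.
rewrite !inE => /andP[/nandP[/negPn->//|kT] ke]; rewrite eT orbT !mulr1.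
have -> : (k |: T) :\ e = k |: T :\ e.
  by apply/setP => x; rewrite !inE; case: (x =P e) => // ->; rewrite eq_sym (negPf ke).
have kT' : k \notin T :\ e by rewrite !inE (negPf kT) andbF.
have -> : incid k T = (-1) ^+ (e < k)%N * incid k (T :\ e).
  by rewrite -{1}(setD1K eT) incidU.
rewrite incidK mulr1 (incidU _ kT').
have [klt|lkt|/val_inj E'] := ltngtP k e; rewrite ?expr0 ?expr1; [ring|ring|].
by rewrite E' eqxx in ke.
Qed.

Lemma exact_empty D i : (forall S, D S -> #|S| != i) -> exact_at D i.
Proof.
move=> nD c cc _; exists (fun=> 0) => // T DT.
rewrite cc; last by rewrite DT nD.
by rewrite /bdry big1 // => k _; rewrite mulr0.
Qed.

End Chains.

(** * Koszul homology of edge rings *)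

Section EdgeRing.

Variables (K : fieldType) (n q : nat) (ends : 'I_q -> 'I_n * 'I_n).
Implicit Types (z : 'X_{1..q}) (v w : 'X_{1..n}) (S T : {set 'I_q}).

Local Notation em := (edge_monomials K ends).
Local Notation I := (@toric_ideal K n q ends).

Definition edge_mnm (e : 'I_q) : 'X_{1..n} := (U_((ends e).1) + U_((ends e).2))%MM.

Definition vmnm z : 'X_{1..n} := (\sum_e edge_mnm e *+ z e)%MM.

Lemma vmnmE z u :
  vmnm z u = (\sum_e z e * (((ends e).1 == u) + ((ends e).2 == u)))%N.
Proof.
rewrite /vmnm mnm_sumE; apply: eq_bigr => e _.
by rewrite mulmnE mnmDE !mnm1E mulnC.
Qed.

Lemma vmnmD z z' : vmnm (z + z') = (vmnm z + vmnm z')%MM.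
Proof.
apply/mnmP => u; rewrite mnmDE !vmnmE -big_split; apply: eq_bigr => e _.
by rewrite mnmDE mulnDl.
Qed.

Lemma vmnm1 e : vmnm U_(e) = edge_mnm e.
Proof.
apply/mnmP => u; rewrite vmnmE (bigD1 e) //= mnm1E eqxx mul1n big1.
  by rewrite addn0 mnmDE !mnm1E.
by move=> i ie; rewrite mnm1E eq_sym (negPf ie).
Qed.

Lemma mdeg_vmnm z : mdeg (vmnm z) = (mdeg z).*2.
Proof.
rewrite /vmnm mdeg_sum mdegE -mul2n big_distrr; apply: eq_bigr => e _ /=.
by rewrite mdegMn /edge_mnm mdegD !mdeg1.
Qed.

Lemma comp_edgeX z : 'X_[z] \mPo em = 'X_[vmnm z].
Proof.
rewrite comp_mpolyX /vmnm.
rewrite (big_morph (fun m : 'X_{1..n} => ('X_[m] : {mpoly K[n]})) (@mpolyXD _ _) (mpolyX0 _ _)).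
by apply: eq_bigr => e _; rewrite tnth_mktuple -mpolyXD mpolyXn.
Qed.

Lemma mcoeff_comp_edge (p : {mpoly K[q]}) v :
  (p \mPo em)@_v = \sum_(m <- msupp p | vmnm m == v) p@_m.
Proof.
rewrite comp_mpolyEX raddf_sum /= [RHS]big_mkcond; apply: eq_bigr => m _.
by rewrite mcoeffZ comp_edgeX mcoeffX; case: eqP; rewrite ?mulr1 ?mulr0.
Qed.

Lemma mcoeff_comp_neq0 (p : {mpoly K[q]}) v : (p \mPo em)@_v != 0 ->
  exists2 m, m \in msupp p & vmnm m = v.
Proof.
rewrite mcoeff_comp_edge => nz.
have /hasP[m mp /eqP E] : has (fun m => vmnm m == v) (msupp p).
  apply: contraNT nz => /hasPn nh; rewrite big_seq_cond big1 // => m /andP[mp].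
  by rewrite (negPf (nh m mp)).
by exists m.
Qed.

Lemma mcoeffXM (N : nat) (p : {mpoly K[N]}) (m w : 'X_{1..N}) :
  ('X_[m] * p)@_w = if (m <= w)%MM then p@_(w - m) else 0.
Proof.
rewrite mulrC; case: ifP => mw.
  by rewrite -{1}(submK mw) addmC mcoeffMX.
apply/eqP; rewrite mcoeff_eq0 (perm_mem (msuppMX p m)); apply/negP.
by case/mapP => x _ E; rewrite E lem_addr in mw.
Qed.

Lemma mcoeff_comp_sign N (p : {mpoly K[q]}) w :
  (((-1) ^+ N * p) \mPo em)@_w = (-1) ^+ N * (p \mPo em)@_w.
Proof.
elim: N => [|N IH]; first by rewrite !expr0 !mul1r.
by rewrite !exprS -!mulrA !mulN1r comp_mpolyN mcoeffN IH.
Qed.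

Lemma comp_koszul (c : {set 'I_q} -> {mpoly K[q]}) T w :
  (koszul_d c T \mPo em)@_w = \sum_(k < q | k \notin T)
    incid K k T * ('X_[edge_mnm k] * (c (k |: T) \mPo em))@_w.
Proof.
rewrite /koszul_d (raddf_sum (comp_mpoly em)) (raddf_sum (mcoeff w)) /=; apply: eq_bigr => k _.
by rewrite -mulrA mcoeff_comp_sign rmorphM /= comp_edgeX vmnm1.
Qed.

Definition smnm S := vmnm (mesym1 S).

Lemma mesym1U1 k T : k \notin T -> mesym1 (k |: T) = (mesym1 T + U_(k))%MM.
Proof.
move=> kT; apply/mnmP=> x; rewrite mnmDE !mnmE !inE eq_sym.
by case: eqP => [<-|_]; rewrite ?(negPf kT) ?addn0.
Qed.

Lemma smnmU1 k T : k \notin T -> smnm (k |: T) = (smnm T + edge_mnm k)%MM.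
Proof. by move=> kT; rewrite /smnm mesym1U1 // vmnmD vmnm1. Qed.

(* The squarefree divisor complex of [v]: the faces contributing to the strand of
   the Koszul complex of the edge ring in multidegree [v]. *)
Definition strand v S :=
  [exists z : 'X_{1..q < (mdeg v).+1}, vmnm (z + mesym1 S) == v].

Lemma strandP v S : reflect (exists z, vmnm (z + mesym1 S) = v) (strand v S).
Proof.
apply: (iffP existsP) => [[z /eqP E]|[z E]]; first by exists z.
suff h : (mdeg z < (mdeg v).+1)%N by exists (BMultinom h); apply/eqP.
by rewrite -E mdeg_vmnm mdegD -addnn; lia.
Qed.

(** The choice is arbitrary in the fibre and made separately for each face, so the factors chosen
    for nested faces need not be related. Outside the strand the value is a dummy. *)
Definition srep v S : 'X_{1..q} :=
  if [pick z : 'X_{1..q < (mdeg v).+1} | vmnm (z + mesym1 S) == v] is Some z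
  then z else 0%MM.

Lemma srepE v S : strand v S -> vmnm (srep v S + mesym1 S) = v.
Proof.
by rewrite /srep => /existsP[z hz]; case: pickP => [z' /eqP|/(_ z)] //; rewrite hz.
Qed.

Lemma strand_sub v k T : strand v (k |: T) -> strand v T.
Proof.
have [kT|kT] := boolP (k \in T); first by rewrite (setUidPr _) // sub1set.
case/strandP => z; rewrite mesym1U1 // => E; apply/strandP.
by exists (z + U_(k))%MM; rewrite -E -addmA (addmC U_(k)%MM).
Qed.

Lemma strand_convex v : convex (strand v).
Proof. by move=> T k l _ /strand_sub. Qed.

(** The edge ring is at most one-dimensional in each vertex multidegree, so the strand of degree v
    has coefficient space K on the faces of [strand v] and 0 elsewhere. An edge has degree 2 in the
    vertices, whence [j.*2]. *)
Lemma betti_strand i j : (forall v, mdeg v = j.*2 -> exact_at K (strand v) i) ->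
  ~ betti_nonzero I i j.
Proof.
move=> ex [ij [c [hc [c0 [cI nb]]]]]; apply: nb.
pose C v S : K := if (smnm S <= v)%MM then (c S \mPo em)@_(v - smnm S) else 0.
have exv (v : 'X_{1..n < j.*2.+1}) : exists b : {set 'I_q} -> K,
    (chain (strand v) i.+1 b /\ (mdeg v != j.*2 -> forall S, b S = 0)) /\
    (mdeg v = j.*2 -> forall T, strand v T -> C v T = bdry (fun=> 1) b T).
  have [dv|dv] := eqVneq (mdeg v) j.*2; last first.
    by exists (fun=> 0); split=> //; move/eqP: dv.
  case: (ex v dv (C v)) => [S|T vT|b cb Eb]; last by exists b; split.
    rewrite /C; case: ifP => // Sv; apply: contraNeq => nz.
    have [m mS Em] := mcoeff_comp_neq0 nz.
    apply/andP; split.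
      by apply/strandP; exists m; rewrite vmnmD Em submK.
    by apply: contraNT nz => /eqP /c0 ->; rewrite comp_mpoly0 mcoeff0.
  have Tv : (smnm T <= v)%MM.
    by case/strandP: vT => z <-; rewrite vmnmD lem_addl.
  have := cI T; rewrite /toric_ideal /= => /eqP /(congr1 (mcoeff (v - smnm T)%MM)).
  rewrite comp_koszul mcoeff0 => E; rewrite -[RHS]E; apply: eq_bigr => k kT.
  have eqle : (edge_mnm k <= v - smnm T)%MM = (smnm T + edge_mnm k <= v)%MM.
    move/mnm_lepP: Tv => Tv.
    by apply/mnm_lepP/mnm_lepP => h x; move: (h x) (Tv x); rewrite mnmBE mnmDE; lia.
  by rewrite mulr1 mcoeffXM /C smnmU1 // submDA eqle.
(* Finitely many multidegrees are concerned, so the bounding chains are chosen all at once; [B']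
   extends them by zero. *)
have [B HB] := fin_all_exists exv.
pose B' v S : K := if insub v is Some bv then B bv S else 0.
have B'0 v S : ~~ (strand v S && (#|S| == i.+1)) -> B' v S = 0.
  rewrite /B'; case: insubP => // bv _ <- nS.
  by have [[h _] _] := HB bv; apply: h.
(* Each scalar is lifted to a monomial with the right image; where [srep] is a dummy, the scalar is
   0. *)
pose b S : {mpoly K[q]} := \sum_(v : 'X_{1..n < j.*2.+1}) B v S *: 'X_[srep v S].
have bE S w : (b S \mPo em)@_w = B' (w + smnm S)%MM S.
  rewrite /b (raddf_sum (comp_mpoly em)) (raddf_sum (mcoeff w)) /=.
  have E (v : 'X_{1..n < j.*2.+1}) : (comp_mpoly em (B v S *: 'X_[srep v S]))@_w =
    if val v == (w + smnm S)%MM then B v S else 0.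
    rewrite comp_mpolyZ mcoeffZ comp_edgeX mcoeffX.
    have [vS|vS] := boolP (strand v S); last first.
      have [[h _] _] := HB v; rewrite h ?mul0r ?if_same //.
      by rewrite (negPf vS).
    have -> : (val v == (w + smnm S)%MM) = (vmnm (srep v S) == w).
      by rewrite -[RHS](eqm_add2r (smnm S)) -vmnmD srepE.
    by case: ifP; rewrite ?mulr1 ?mulr0.
  rewrite (eq_bigr _ (fun (v : 'X_{1..n < j.*2.+1}) _ => E v)) -big_mkcond /B'.
  case: insubP => [bv _ <-|nv]; last first.
    by rewrite big1 // => v /eqP Ev; rewrite -Ev bmdeg in nv.
  by rewrite (big_pred1 bv).
exists b; split=> [S nS|S].
  rewrite /b big1 // => v _; have [[h _] _] := HB v.
  by rewrite h ?scale0r //; apply/negP => /andP[_ /eqP].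
rewrite /toric_ideal /=; apply/eqP/mpolyP => w; rewrite mcoeff0 raddfB /= mcoeffB.
apply/eqP; rewrite subr_eq0; apply/eqP; set v := (w + smnm S)%MM.
have dE : (koszul_d b S \mPo em)@_w = bdry (fun=> 1) (B' v) S.
  rewrite comp_koszul; apply: eq_bigr => k kS; rewrite mulr1 mcoeffXM bE smnmU1 //.
  congr (_ * _); case: ifP => kw.
    by rewrite (addmC (smnm S)) addmA submK.
  rewrite B'0 //; apply: contraFN kw => /andP[/strandP[z]].
  rewrite vmnmD -/(smnm _) smnmU1 // (addmC (smnm S)) addmA => /addIm <- _.
  exact: lem_addl.
have CE : (c S \mPo em)@_w = C v S.
  by rewrite /C lem_addl addmK.
rewrite dE CE; have [vS|vS] := boolP (strand v S); last first.
  rewrite [RHS]big1; last first.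
    move=> k kS; rewrite B'0 ?mulr0 //; apply/negP=> /andP[/strand_sub h _].
    by rewrite h in vS.
  rewrite -CE; apply/eqP; apply: contraNT vS => /mcoeff_comp_neq0[m _ Em].
  by apply/strandP; exists m; rewrite vmnmD Em.
have [dv|dv] := eqVneq (mdeg v) j.*2.
  have bv : (mdeg v < j.*2.+1)%N by rewrite dv.
  have [_ h] := HB (BMultinom bv); rewrite (h dv S vS).
  by apply: bdry_ext => k _; rewrite /B' insubT.
rewrite [RHS]big1; last first.
  move=> k kS; rewrite /B'; case: insubP => [bv _ Ev|_]; last by rewrite mulr0.
  by have [[_ h] _] := HB bv; rewrite h ?mulr0 // Ev.
(* In a multidegree of the wrong total degree, homogeneity of [c] leaves no coefficient. *)
rewrite -CE; apply/eqP; apply: contraNT dv => nz.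
have [m mS Em] := mcoeff_comp_neq0 nz.
have Si : #|S| = i.
  by apply/eqP; apply: contraNT nz => /eqP /c0 ->; rewrite comp_mpoly0 mcoeff0.
rewrite /v mdegD -Em /smnm !mdeg_vmnm mdeg_mesym1 Si.
by rewrite (dhomog_mf (hc S Si) mS) -doubleD subnK.
Qed.

End EdgeRing.

(** * The graph and the fibres of its toric map *)

Section Graph.

Variables s k : nat.

Local Notation c := s.*2.+4.+2.
Local Notation n := (c + k)%N.
Local Notation q := (k + k + c)%N.

(* The cycle vertices are u_0, ..., u_(c-1), with edges u_j -- u_(nxt j): a
   triangle through x = u_0 and an odd cycle through y = u_3. *)
Definition nxtn (j : nat) : nat :=
  if j == 2%N then 0%N else if j == s.*2.+4.+1 then 3%N else j.+1.
Definition prvn (j : nat) : nat :=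
  if j == 0%N then 2%N else if j == 3%N then s.*2.+4.+1 else j.-1.
Definition nxt (j : 'I_c) : 'I_c := inord (nxtn j).
Definition prv (j : 'I_c) : 'I_c := inord (prvn j).

Lemma nxtE (j : 'I_c) : nxt j = nxtn j :> nat.
Proof.
rewrite /nxt inordK // /nxtn; have := ltn_ord j; do 2!case: eqP => //=; lia.
Qed.

Lemma prvE (j : 'I_c) : prv j = prvn j :> nat.
Proof.
rewrite /prv inordK // /prvn; have := ltn_ord j; do 2!case: eqP => //=; lia.
Qed.

Lemma nxt_eq (j w : 'I_c) : (nxt j == w) = (j == prv w).
Proof.
rewrite -!(inj_eq val_inj) /= nxtE prvE /nxtn /prvn.
by have := ltn_ord j; have := ltn_ord w; do !case: eqP => //=; lia.
Qed.

Definition vu (j : 'I_c) : 'I_n := lshift k j.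
Definition vt (i : 'I_k) : 'I_n := rshift c i.
Definition vx : 'I_c := inord 0.
Definition vy : 'I_c := inord 3.

Definition ea (i : 'I_k) : 'I_q := lshift c (lshift k i).
Definition eb (i : 'I_k) : 'I_q := lshift c (rshift k i).
Definition ee (j : 'I_c) : 'I_q := rshift (k + k) j.

Definition bicycle (e : 'I_q) : 'I_n * 'I_n :=
  match split e with
  | inl f => match split f with
             | inl i => (vu vx, vt i)
             | inr i => (vu vy, vt i)
             end
  | inr j => (vu j, vu (nxt j))
  end.

Lemma ends_ea i : bicycle (ea i) = (vu vx, vt i).
Proof. by rewrite /bicycle /ea !(unsplitK (inl _)). Qed.

Lemma ends_eb i : bicycle (eb i) = (vu vy, vt i).
Proof. by rewrite /bicycle /eb (unsplitK (inl _)) (unsplitK (inr _)). Qed.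

Lemma ends_ee j : bicycle (ee j) = (vu j, vu (nxt j)).
Proof. by rewrite /bicycle /ee (unsplitK (inr _)). Qed.

Variant edge_spec : 'I_q -> Type :=
  | EdgeA i : edge_spec (ea i)
  | EdgeB i : edge_spec (eb i)
  | EdgeE j : edge_spec (ee j).

Lemma edgeP e : edge_spec e.
Proof.
by case: (split_ordP e) => [f ->|j ->]; [case: (split_ordP f) => i ->|]; constructor.
Qed.

Lemma ea_inj : injective ea. Proof. by move=> i j /lshift_inj /lshift_inj. Qed.
Lemma eb_inj : injective eb. Proof. by move=> i j /lshift_inj /rshift_inj. Qed.
Lemma ee_inj : injective ee. Proof. by move=> i j /rshift_inj. Qed.

Lemma eq_ea i j : (ea i == ea j) = (i == j). Proof. exact: inj_eq ea_inj _ _. Qed.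
Lemma eq_eb i j : (eb i == eb j) = (i == j). Proof. exact: inj_eq eb_inj _ _. Qed.
Lemma eq_ee i j : (ee i == ee j) = (i == j). Proof. exact: inj_eq ee_inj _ _. Qed.

Lemma eq_eab i j : (ea i == eb j) = false.
Proof. by rewrite /ea /eb (inj_eq (@lshift_inj _ _)) eq_lrshift. Qed.
Lemma eq_eba i j : (eb i == ea j) = false.
Proof. by rewrite eq_sym eq_eab. Qed.
Lemma eq_eae i j : (ea i == ee j) = false. Proof. by rewrite eq_lrshift. Qed.
Lemma eq_eea i j : (ee i == ea j) = false. Proof. by rewrite eq_rlshift. Qed.
Lemma eq_ebe i j : (eb i == ee j) = false. Proof. by rewrite eq_lrshift. Qed.
Lemma eq_eeb i j : (ee i == eb j) = false. Proof. by rewrite eq_rlshift. Qed.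

Definition edge_eqE :=
  (eq_ea, eq_eb, eq_ee, eq_eab, eq_eba, eq_eae, eq_eea, eq_ebe, eq_eeb).

Lemma eq_vu i j : (vu i == vu j) = (i == j). Proof. exact: eq_lshift. Qed.
Lemma eq_vt i j : (vt i == vt j) = (i == j). Proof. exact: eq_rshift. Qed.
Lemma eq_vut i j : (vu i == vt j) = false. Proof. exact: eq_lrshift. Qed.
Lemma eq_vtu i j : (vt i == vu j) = false. Proof. exact: eq_rlshift. Qed.

Definition vertex_eqE := (eq_vu, eq_vt, eq_vut, eq_vtu).

Lemma vx_vy : (vx == vy) = false.
Proof. by rewrite -(inj_eq val_inj) /= !inordK. Qed.

Lemma set2_eq (T : finType) (a b a' b' : T) :
  [set a; b] = [set a'; b'] -> (a == a') && (b == b') || (a == b') && (b == a').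
Proof.
move=> E.
have := set21 a b; have := set22 a b; rewrite E !inE.
have := set21 a' b'; have := set22 a' b'; rewrite -E !inE.
rewrite ![a' == _]eq_sym ![b' == _]eq_sym.
by do !case: (_ == _).
Qed.

Lemma bicycle_simple : simple_graph bicycle.
Proof.
have nn (j : 'I_c) : (j == nxt j) = false.
  apply/negbTE; rewrite -(inj_eq val_inj) /= nxtE /nxtn.
  by have := ltn_ord j; case: ifP => ?; [|case: ifP => ?]; lia.
(* Both cycles have length at least 3, so no edge recurs in the opposite direction. *)
have nnn (j l : 'I_c) : j == nxt l -> nxt j == l -> False.
  rewrite -!(inj_eq val_inj) /= !nxtE /nxtn.
  have := ltn_ord j; have := ltn_ord l.
  by case: ifP => ?; [|case: ifP => ?]; (case: ifP => ?; [|case: ifP => ?]); lia.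
split=> [e|e f].
  by case: (edgeP e) => i; rewrite (ends_ea, ends_eb, ends_ee) /= vertex_eqE ?nn.
apply: contra_neq => /set2_eq.
case: (edgeP e) => i; case: (edgeP f) => j; rewrite ?(ends_ea, ends_eb, ends_ee) /= !vertex_eqE
  ?(eq_sym vy) ?vx_vy ?eqxx ?andbF ?orbF //=; [by move/eqP->|by move/eqP->|].
case/orP=> [/andP[/eqP-> _]|/andP[h1 h2]] //; by case: (nnn i j).
Qed.

Lemma bicycle_connected : (0 < k)%N -> connected_graph bicycle.
Proof.
move=> k0; split=> //.
pose t0 : 'I_k := Ordinal k0.
have sym : connect_sym (adj bicycle).
  apply: sym_connect_sym => u v; rewrite /adj; apply: eq_existsb => e.
  by rewrite orbC.
have ed e : connect (adj bicycle) (bicycle e).1 (bicycle e).2.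
  by apply/connect1/existsP; exists e; rewrite -surjective_pairing eqxx.
have A i : connect (adj bicycle) (vu vx) (vt i) by have := ed (ea i); rewrite ends_ea.
have B i : connect (adj bicycle) (vu vy) (vt i) by have := ed (eb i); rewrite ends_eb.
have xy : connect (adj bicycle) (vu vx) (vu vy).
  by apply: connect_trans (A t0) _; rewrite sym.
have U (j : nat) (hj : (j < c)%N) : connect (adj bicycle) (vu vx) (vu (inord j)).
  elim: j hj => [|j IH] hj; first exact: connect0.
  (* No cycle edge joins vertices 2 and 3; the second cycle is entered through t_0. *)
  have [E|j3] := eqVneq j.+1 3%N; first by rewrite E.
  apply: connect_trans (IH (ltnW hj)) _.
  have := ed (ee (inord j)); rewrite ends_ee /=.
  suff -> : nxt (inord j) = inord j.+1 by [].
  apply: val_inj; rewrite /= nxtE !inordK //; last exact: ltnW.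
  by rewrite /nxtn; case: ifP => ?; [|case: ifP => ?]; lia.
have all u : connect (adj bicycle) (vu vx) u.
  case: (split_ordP u) => [j ->|i ->]; last exact: A.
  by have := U j (ltn_ord j); rewrite inord_val.
by move=> u v; apply: connect_trans (all v); rewrite sym.
Qed.

Implicit Types (z : 'X_{1..q}).
Local Notation vm := (vmnm bicycle).

Lemma sum_edge (f : 'I_q -> nat) :
  (\sum_e f e = \sum_i f (ea i) + \sum_i f (eb i) + \sum_j f (ee j))%N.
Proof. by rewrite !big_split_ord. Qed.

Definition sumA z : nat := (\sum_i z (ea i))%N.
Definition sumB z : nat := (\sum_i z (eb i))%N.

Lemma sum_delta (N : nat) (f : 'I_N -> nat) i :
  (\sum_j f j * (j == i) = f i)%N.
Proof.
by rewrite (bigD1 i) //= eqxx muln1 big1 ?addn0 // => j /negPf->; rewrite muln0.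
Qed.

Lemma vmnm_t z i : vm z (vt i) = (z (ea i) + z (eb i))%N.
Proof.
rewrite vmnmE sum_edge.
rewrite (eq_bigr (fun j => z (ea j) * (j == i))%N); last first.
  by move=> j _; rewrite ends_ea /= !vertex_eqE.
rewrite sum_delta.
rewrite (eq_bigr (fun j => z (eb j) * (j == i))%N); last first.
  by move=> j _; rewrite ends_eb /= !vertex_eqE.
rewrite sum_delta big1 ?addn0 // => j _.
by rewrite ends_ee /= !vertex_eqE muln0.
Qed.

Lemma vmnm_u z w : vm z (vu w) =
  ((w == vx) * sumA z + (w == vy) * sumB z + (z (ee w) + z (ee (prv w))))%N.
Proof.
rewrite vmnmE sum_edge; congr (_ + _ + _)%N.
- rewrite /sumA big_distrr; apply: eq_bigr => j _ /=.
  by rewrite ends_ea /= !vertex_eqE addn0 mulnC eq_sym.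
- rewrite /sumB big_distrr; apply: eq_bigr => j _ /=.
  by rewrite ends_eb /= !vertex_eqE addn0 mulnC eq_sym.
rewrite (eq_bigr (fun j => z (ee j) * (j == w) + z (ee j) * (j == prv w)))%N.
  by rewrite big_split /= (sum_delta (fun j => z (ee j)) w) (sum_delta (fun j => z (ee j)) (prv w)).
by move=> j _; rewrite ends_ee /= !vertex_eqE nxt_eq mulnDr.
Qed.

Definition alt (j : nat) : int := if odd j then -1 else 1.

Lemma sumAB z z' : (forall i, (z (ea i) + z (eb i) = z' (ea i) + z' (eb i))%N) ->
  (sumA z + sumB z = sumA z' + sumB z')%N.
Proof.
by move=> E; rewrite /sumA /sumB -!big_split; apply: eq_bigr => i _; apply: E.
Qed.

(* [d] is the multiplicity of the relation P y^2 = Q x^2. *)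
Lemma fiberP z z' : vm z = vm z' <->
  exists d : int, [/\ forall i, (z (ea i) + z (eb i) = z' (ea i) + z' (eb i))%N,
    forall j : 'I_c, (z (ee j))%:Z = (z' (ee j))%:Z + alt j * d &
    (sumA z)%:Z = (sumA z')%:Z - 2 * d].
Proof.
split=> [E|[d [Et Ee EA]]]; last first.
  have EAB := sumAB Et.
  apply/mnmP => u; case: (split_ordP u) => [w ->|i ->]; last by rewrite !vmnm_t.
  rewrite -/(vu w) !vmnm_u; have := Ee w; have := Ee (prv w).
  rewrite -!(inj_eq val_inj) /= prvE !inordK // /prvn /alt.
  case: (nat_of_ord w =P 0%N) => [->|w0] /=; first lia.
  case: (nat_of_ord w =P 3) => [->|w3] /=; first by rewrite odd_double /=; lia.
  by case: (nat_of_ord w) w0 => //= w' _; case: odd => /=; lia.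
have Et i : (z (ea i) + z (eb i) = z' (ea i) + z' (eb i))%N.
  by rewrite -!vmnm_t E.
have Eu w : vm z (vu w) = vm z' (vu w) by rewrite E.
have EAB := sumAB Et.
pose d : int := (z (ee vx))%:Z - (z' (ee vx))%:Z.
pose D (j : nat) : int := (z (ee (inord j)))%:Z - (z' (ee (inord j)))%:Z.
(* Only two edges meet at a cycle vertex other than x and y, so their exponent differences are
   opposite. *)
have Estep (j : nat) : (j.+1 < c)%N -> j.+1 != 3%N -> D j.+1 = - D j.
  move=> hj j3; have := Eu (inord j.+1); rewrite !vmnm_u /D.
  have -> : prv (inord j.+1) = inord j.
    apply: val_inj; rewrite /= prvE !inordK //; last exact: ltnW.
    by rewrite /prvn (negPf j3).
  rewrite -!(inj_eq val_inj) /= !inordK // (negPf j3) /=; lia.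
have E0 : D 0%N = d by [].
have E2 : D 2%N = d by rewrite !Estep // E0 opprK.
(* The triangle being odd, both its edges at x have difference d; only the a_i can compensate 2d. *)
have EA : (sumA z)%:Z = (sumA z')%:Z - 2 * d.
  have := Eu vx; rewrite !vmnm_u eqxx vx_vy.
  have -> : prv vx = inord 2 by apply: val_inj; rewrite /= prvE !inordK.
  by move: E2; rewrite /d /D; lia.
have E4 (i : nat) : (3 + i < c)%N -> D (3 + i)%N = alt i * D 3%N.
  elim: i => [|i IH] hi; first by rewrite mul1r.
  rewrite addnS Estep; [|by rewrite -addnS|lia].
  by rewrite IH ?(ltn_trans _ hi) ?ltn_add2l // /alt /=; case: odd => /=; lia.
(* Both cycle edges at y also share one difference, and twice it cancels the change 2d in the
   exponents of the b_i. *)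
have E3 : D 3%N = - d.
  have := Eu vy; rewrite !vmnm_u eqxx (eq_sym vy) vx_vy.
  have -> : prv vy = inord s.*2.+4.+1.
    by apply: val_inj; rewrite /= prvE !inordK // /prvn.
  have : D s.*2.+4.+1 = D 3%N.
    by have := E4 s.*2.+2; rewrite /alt /= odd_double mul1r; apply; lia.
  by rewrite /D; move: E2 EA; rewrite /d /D /vy; lia.
exists d; split=> // j.
suff : D j = alt j * d by rewrite /D inord_val; lia.
have [j3|j3] := leqP 3 j.
  have := E4 (j - 3)%N; rewrite subnKC // => -> //; rewrite E3.
  have : odd j = ~~ odd (j - 3) by rewrite -{1}(subnKC j3) oddD.
  by rewrite /alt => ->; case: odd => /=; lia.
case: (nat_of_ord j) j3 => [|[|[|]]] //= _; rewrite ?Estep // /alt /= ?E0; lia.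
Qed.

End Graph.

(** * Counting monomials *)

Section Counting.

Variable N : nat.
Implicit Types (D P : 'X_{1..N} -> bool) (z : 'X_{1..N}) (F : {set 'I_N}).

Definition cnt D (d : nat) : nat := #|[set z : 'X_{1..N < d.+1} | (mdeg z == d) && D z]|.

Lemma cnt_ext D D' : D =1 D' -> cnt D =1 cnt D'.
Proof. by move=> E d; apply: eq_card => z; rewrite !inE E. Qed.

Lemma cnt_split D P d :
  cnt D d = (cnt (fun z => D z && P z) d + cnt (fun z => D z && ~~ P z) d)%N.
Proof.
rewrite /cnt -(cardsID [set z : 'X_{1..N < d.+1} | P z]); congr (_ + _)%N;
  apply: eq_card => z; rewrite !inE; first by rewrite andbA.
by rewrite andbC andbA.
Qed.

Lemma cnt_inj D D' d d' (f : 'X_{1..N} -> 'X_{1..N}) :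
  (forall z, mdeg z = d -> D z -> mdeg (f z) = d' /\ D' (f z)) ->
  (forall z z', D z -> D z' -> f z = f z' -> z = z') -> (cnt D d <= cnt D' d')%N.
Proof.
move=> fD finj; rewrite /cnt.
pose g (z : 'X_{1..N < d.+1}) : 'X_{1..N < d'.+1} := insubd bm0 (f z).
have gE (z : 'X_{1..N < d.+1}) : mdeg z = d -> D z -> val (g z) = f z.
  by move=> dz Dz; rewrite insubdK // unfold_in; have [-> _] := fD z dz Dz.
rewrite -(card_in_imset (f := g)).
  apply/subset_leq_card/subsetP => y /imsetP[z]; rewrite inE => /andP[/eqP dz Dz] ->.
  by have [h1 h2] := fD z dz Dz; rewrite inE (gE z dz Dz) h1 eqxx.
move=> z z'; rewrite !inE => /andP[/eqP dz Dz] /andP[/eqP dz' Dz'] E.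
by apply/val_inj/finj => //; rewrite -!gE ?E.
Qed.

(** Multiplication of a power series by 1 - x, on coefficients. *)
Definition dif (f : nat -> int) (d : nat) : int := f d - (if d is d'.+1 then f d' else 0).

(* [HS D e h] says that the generating series of [cnt D] is [h / (1 - x)^e]. *)
Definition HS D (e : nat) (h : {poly int}) : Prop :=
  forall d, iter e dif (fun d' => (cnt D d')%:Z) d = h`_d.

Lemma iter_dif_ext e f g : f =1 g -> iter e dif f =1 iter e dif g.
Proof.
move=> E; elim: e => [|e IH] //= d; rewrite /dif IH.
by case: d => // d; rewrite IH.
Qed.

Lemma iter_difD e f g d :
  iter e dif (fun d => f d + g d) d = iter e dif f d + iter e dif g d.
Proof.
elim: e d => [|e IH] //= d; rewrite /dif !IH.
by case: d => [|d]; rewrite ?IH; ring.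
Qed.

(** Turns iterated differences into the binomial sum of [h_polynomial_is]. *)
Lemma iter_difE e f d : iter e dif f d =
  \sum_(t < e.+1 | (t <= d)%N) (-1) ^+ t * ('C(e, t))%:Z * f (d - t)%N.
Proof.
pose f' d t := if (t <= d)%N then f (d - t)%N else 0.
have -> : \sum_(t < e.+1 | (t <= d)%N) (-1) ^+ t * ('C(e, t))%:Z * f (d - t)%N =
    \sum_(t < e.+1) (-1) ^+ t * ('C(e, t))%:Z * f' d t.
  by rewrite big_mkcond; apply: eq_bigr => t _; rewrite /f'; case: ifP; rewrite ?mulr0.
elim: e d => [|e IH] d.
  by rewrite big_ord1 /f' /= bin0 subn0 !mul1r.
rewrite iterS /dif IH big_ord_recl [in RHS]big_ord_recl /= !bin0 -addrA; congr (_ + _).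
have -> : (if d is d'.+1 then iter e dif f d' else 0) =
    \sum_(t < e.+1) (-1) ^+ t * ('C(e, t))%:Z * f' d t.+1.
  case: d => [|d]; last by rewrite IH.
  by rewrite big1 // => t _; rewrite /f' mulr0.
have -> : \sum_(t < e) (-1) ^+ bump 0 t * ('C(e, bump 0 t))%:Z * f' d (bump 0 t) =
    \sum_(t < e.+1) (-1) ^+ t.+1 * ('C(e, t.+1))%:Z * f' d t.+1.
  by rewrite [RHS]big_ord_recr /= bin_small // mulr0 mul0r addr0.
rewrite -sumrB; apply: eq_bigr => t _; rewrite /bump add1n binS PoszD exprS; ring.
Qed.

Lemma HS_ext D D' e h : D =1 D' -> HS D e h -> HS D' e h.
Proof.
move=> E H d; rewrite -H; apply: iter_dif_ext => d'.
by rewrite (cnt_ext E).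
Qed.

Lemma HS_union D P e h h' : HS (fun z => D z && P z) e h ->
  HS (fun z => D z && ~~ P z) e h' -> HS D e (h + h').
Proof.
move=> H H' d; rewrite coefD -H -H' -iter_difD; apply: iter_dif_ext => d'.
by rewrite (cnt_split D P).
Qed.

Lemma HS_diff D P e h h' : HS D e h -> HS (fun z => D z && P z) e h' ->
  HS (fun z => D z && ~~ P z) e (h - h').
Proof.
move=> H H' d; apply: (@addrI _ (h'`_d)); rewrite coefB addrCA subrr addr0 -H -H' -iter_difD.
by apply: iter_dif_ext => d'; rewrite (cnt_split D P).
Qed.

Lemma coef_1subXM (h : {poly int}) d : ((1 - 'X) * h)`_d = dif (fun i => h`_i) d.
Proof. by rewrite mulrBl mul1r coefB coefXM /dif; case: d. Qed.

Lemma HS_raise D e f h : HS D e h -> HS D (f + e) ((1 - 'X) ^+ f * h).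
Proof.
move=> H; elim: f => [|f IH]; first by rewrite mul1r.
move=> d; rewrite exprS -mulrA coef_1subXM addSn iterS /dif IH.
by case: d => // d; rewrite IH.
Qed.

Lemma HS_lower D e h : HS D e.+1 ((1 - 'X) * h) -> HS D e h.
Proof.
move=> H; elim=> [|d IH]; have := H; [move/(_ 0%N)|move/(_ d.+1)];
  rewrite iterS coef_1subXM /dif ?subr0 //.
by rewrite IH => /addIr.
Qed.

(** Multiplication by the variable x maps [D] injectively into itself, so the elements outside its
    image span the quotient and their series is that of [D] times 1 - x. *)
Lemma HS_toggle D x e h : (forall z, D z -> D (z + U_(x))%MM) ->
  HS (fun z => D z && ~~ ((0 < z x)%N && D (z - U_(x))%MM)) e h -> HS D e.+1 h.
Proof.
move=> up H d; rewrite iterSr -H; apply: iter_dif_ext => {}d.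
have U1 (z : 'X_{1..N}) : (0 < z x)%N -> (z - U_(x) + U_(x) = z)%MM.
  by move=> zx; rewrite submK // lep1mP -lt0n.
rewrite /dif (cnt_split D (fun z => (0 < z x)%N && D (z - U_(x))%MM)).
rewrite PoszD.
suff -> : (cnt (fun z => D z && ((0 < z x)%N && D (z - U_(x))%MM)) d)%:Z =
          (if d is d'.+1 then (cnt D d')%:Z else 0) by rewrite addrAC subrr add0r.
case: d => [|d].
  congr Posz; apply/eqP; rewrite cards_eq0; apply/eqP/setP => z; rewrite !inE.
  apply/negP => /andP[]; rewrite mdeg_eq0 => /eqP ->.
  by rewrite mnm0E ltnn /= andbF.
congr Posz; apply/eqP; rewrite eqn_leq; apply/andP; split.
  apply: (@cnt_inj _ _ _ _ (fun z => z - U_(x))%MM).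
    move=> z dz /andP[_ /andP[z0 Dz]]; split=> //.
    by move: dz; rewrite -{1}(U1 z z0) mdegD mdeg1 addn1 => -[].
  move=> z z' /andP[_ /andP[z0 _]] /andP[_ /andP[z0' _]] E.
  by rewrite -(U1 z z0) -(U1 z' z0') E.
apply: (@cnt_inj _ _ _ _ (fun z => z + U_(x))%MM) => [z dz Dz|z z' _ _ /addIm //].
by rewrite mdegD mdeg1 addn1 dz addmK Dz up // mnmDE mnm1E eqxx addn1.
Qed.

(** The monomial basis of z0 times the polynomial ring in the variables of [F] (a Stanley space). *)
Definition box z0 F z := [forall x, (z0 x <= z x)%N && ((x \in F) || (z x == z0 x))].

Lemma boxP z0 F z :
  reflect (forall x, (z0 x <= z x)%N /\ (x \notin F -> z x = z0 x)) (box z0 F z).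
Proof.
apply: (iffP forallP) => H x.
  have /andP[h1 h2] := H x; split=> // nF.
  by move: h2; rewrite (negPf nF) => /eqP.
have [-> h] := H x; case: (boolP (x \in F)) => //= nF.
by rewrite h.
Qed.

Lemma boxD z0 F x z : x \in F -> box z0 F z -> box z0 F (z + U_(x))%MM.
Proof.
move=> xF /boxP H; apply/boxP => y; have [h1 h2] := H y; rewrite mnmDE mnm1E.
split; first exact: leq_trans (leq_addr _ _).
by move=> yF; rewrite h2 //; case: eqP => [E|_]; [rewrite -E xF in yF|rewrite addn0].
Qed.

Lemma boxB z0 F x z : x \in F -> (z0 x <= z x)%N -> box z0 F (z + U_(x))%MM -> box z0 F z.
Proof.
move=> xF zx /boxP H; apply/boxP => y; have := H y; rewrite mnmDE mnm1E.
by case: eqP => [<-|_]; rewrite ?addn0 // xF; split.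
Qed.

Lemma HS_box z0 F : HS (box z0 F) #|F| 'X^(mdeg z0).
Proof.
move: {2}#|F| (erefl #|F|) => f; elim: f F => [|f IH] F Ff.
  move/eqP: Ff; rewrite cards_eq0 => /eqP->; rewrite cards0 => d.
  rewrite coefXn /=.
  suff -> : cnt (box z0 set0) d = nat_of_bool (d == mdeg z0) by case: (d == _).
  have bE z : box z0 set0 z = (z == z0).
    apply/boxP/eqP => [H|-> //]; apply/mnmP => x; have [_ ->//] := H x.
    by rewrite inE.
  rewrite (cnt_ext bE) /cnt; case: eqP => [->|ne].
    rewrite (_ : [set z : 'X_{1..N < (mdeg z0).+1} | _] =
                [set BMultinom (ltnSn (mdeg z0))]) ?cards1 //.
    apply/setP => z; rewrite !inE; apply/andP/eqP => [[_ /eqP E]|->] /=; first exact: val_inj.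
    by rewrite !eqxx.
  apply/eqP; rewrite cards_eq0; apply/eqP/setP => z; rewrite !inE.
  by apply/negP => /andP[/eqP dz /eqP zz]; rewrite zz in dz; rewrite dz in ne.
have [x xF] : exists x, x \in F by apply/set0Pn; rewrite -cards_eq0 Ff.
have Fx : #|F :\ x| = f by move: Ff; rewrite (cardsD1 x) xF => -[].
rewrite Ff; apply: (@HS_toggle _ x).
  by move=> z; apply: boxD.
rewrite -Fx; apply: HS_ext (IH _ Fx) => z.
apply/boxP/andP => [H|[/boxP H nx] y].
  split.
    apply/boxP => y; have [h1 h2] := H y; split=> // yF; apply: h2.
    by rewrite !inE (negPf yF) andbF.
  have [_ h] := H x; rewrite h ?setD11 //; apply/negP => /andP[zx /boxP /(_ x)[]].
  by rewrite mnmBE mnm1E eqxx h ?setD11 //; lia.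
have [h1 h2] := H y; split=> //; rewrite !inE negb_and negbK => /orP[/eqP->|]; last exact: h2.
have [h3 _] := H x; apply/eqP; rewrite eqn_leq h3 andbT leqNgt; apply: contra nx => lt.
have zx : (0 < z x)%N := leq_ltn_trans (leq0n _) lt.
rewrite zx; apply: (boxB xF); last by rewrite submK ?lep1mP -?lt0n //; apply/boxP.
by rewrite mnmBE mnm1E eqxx; lia.
Qed.

End Counting.

(** * Standard monomials and the h-polynomial *)

Section NormalForms.

Variables s k : nat.

Local Notation c := s.*2.+4.+2.
Local Notation n := (c + k)%N.
Local Notation q := (k + k + c)%N.
Local Notation vm := (vmnm (@bicycle s k)).
Local Notation ea := (ea s).
Local Notation eb := (eb s).
Local Notation ee := (@ee s k).

Implicit Types (z w : 'X_{1..q}) (i l : 'I_k) (j : 'I_c).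

(* The monomials P and Q: the products of the cycle edges of even and odd index. *)
Definition Pm : 'X_{1..q} :=
  [multinom (if split e is inr j then nat_of_bool (~~ odd j) else 0%N) | e < q].
Definition Qm : 'X_{1..q} :=
  [multinom (if split e is inr j then nat_of_bool (odd j) else 0%N) | e < q].

Lemma Pm_ee j : Pm (ee j) = ~~ odd j.
Proof. by rewrite mnmE (unsplitK (inr _)). Qed.
Lemma Pm_ea i : Pm (ea i) = 0%N.
Proof. by rewrite mnmE (unsplitK (inl _)). Qed.
Lemma Pm_eb i : Pm (eb i) = 0%N.
Proof. by rewrite mnmE (unsplitK (inl _)). Qed.
Lemma Qm_ee j : Qm (ee j) = odd j.
Proof. by rewrite mnmE (unsplitK (inr _)). Qed.
Lemma Qm_ea i : Qm (ea i) = 0%N.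
Proof. by rewrite mnmE (unsplitK (inl _)). Qed.
Lemma Qm_eb i : Qm (eb i) = 0%N.
Proof. by rewrite mnmE (unsplitK (inl _)). Qed.

Local Notation mnm_edgeE :=
  (mnmDE, mnm1E, (@edge_eqE s k), Pm_ee, Pm_ea, Pm_eb, Qm_ee, Qm_ea, Qm_eb, addn0, add0n).

Lemma eq_mnm_edge z w : (forall i, z (ea i) = w (ea i)) ->
  (forall i, z (eb i) = w (eb i)) -> (forall j, z (ee j) = w (ee j)) -> z = w.
Proof. by move=> A B E; apply/mnmP => e; case: (edgeP e). Qed.

Lemma sum_even N : (\sum_(j < N.*2) ~~ odd j = N)%N.
Proof.
elim: N => [|N IH]; first by rewrite big_ord0.
by rewrite doubleS !big_ord_recr /= IH odd_double /= addn1 addn0.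
Qed.

Lemma mdeg_Pm : mdeg Pm = s.+3.
Proof.
rewrite mdegE sum_edge [X in (X + _ + _)%N]big1 => [|i _]; last exact: Pm_ea.
rewrite [X in (_ + X + _)%N]big1 => [|i _]; last exact: Pm_eb.
rewrite !add0n -[RHS](sum_even s.+3); apply: eq_bigr => j _; exact: Pm_ee.
Qed.

Lemma sumAD z w : sumA (z + w)%MM = (sumA z + sumA w)%N.
Proof. by rewrite /sumA -big_split; apply: eq_bigr => i _; rewrite mnmDE. Qed.
Lemma sumBD z w : sumB (z + w)%MM = (sumB z + sumB w)%N.
Proof. by rewrite /sumB -big_split; apply: eq_bigr => i _; rewrite mnmDE. Qed.

Lemma sum_pred1 (i : 'I_k) : (\sum_l (i == l) = 1)%N.
Proof. by rewrite (bigD1 i) //= eqxx big1 // => l; rewrite eq_sym => /negPf->. Qed.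

Lemma sumA_ea i : sumA U_(ea i)%MM = 1%N.
Proof. by rewrite /sumA -[RHS](sum_pred1 i); apply: eq_bigr => l _; rewrite !mnm_edgeE. Qed.
Lemma sumA_eb i : sumA U_(eb i)%MM = 0%N.
Proof. by rewrite /sumA big1 // => l _; rewrite !mnm_edgeE. Qed.
Lemma sumB_ea i : sumB U_(ea i)%MM = 0%N.
Proof. by rewrite /sumB big1 // => l _; rewrite !mnm_edgeE. Qed.
Lemma sumB_eb i : sumB U_(eb i)%MM = 1%N.
Proof. by rewrite /sumB -[RHS](sum_pred1 i); apply: eq_bigr => l _; rewrite !mnm_edgeE. Qed.
Lemma sumA_Pm : sumA Pm = 0%N.
Proof. by rewrite /sumA big1 // => l _; rewrite Pm_ea. Qed.
Lemma sumB_Pm : sumB Pm = 0%N.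
Proof. by rewrite /sumB big1 // => l _; rewrite Pm_eb. Qed.
Lemma sumA_Qm : sumA Qm = 0%N.
Proof. by rewrite /sumA big1 // => l _; rewrite Qm_ea. Qed.
Definition sumE := (sumAD, sumBD, sumA_ea, sumA_eb, sumB_ea, sumB_eb, sumA_Pm,
  sumB_Pm, sumA_Qm).

Lemma vm_swap w i l :
  vm (w + (U_(ea i) + U_(eb l)))%MM = vm (w + (U_(ea l) + U_(eb i)))%MM.
Proof.
apply/fiberP; exists 0; split=> [i'|j|].
- by rewrite !mnm_edgeE; lia.
- by rewrite !mnm_edgeE mulr0 addr0.
- by rewrite !sumE mulr0 subr0.
Qed.

Lemma vm_flip w i l :
  vm (w + (Pm + (U_(eb i) + U_(eb l))))%MM = vm (w + (Qm + (U_(ea i) + U_(ea l))))%MM.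
Proof.
apply/fiberP; exists 1; split=> [i'|j|].
- by rewrite !mnm_edgeE; lia.
- by rewrite !mnm_edgeE /alt; case: odd => /=; lia.
- by rewrite !sumE; lia.
Qed.

Lemma sum_gt0 (f : 'I_k -> nat) : (0 < \sum_i f i)%N -> exists i, (0 < f i)%N.
Proof. by rewrite lt0n sum_nat_eq0 negb_forall => /existsP[i h]; exists i; rewrite lt0n. Qed.

Lemma sumB_gt0 z : (0 < sumB z)%N -> exists i, (U_(eb i) <= z)%MM.
Proof. by move/sum_gt0 => [i h]; exists i; rewrite lep1mP -lt0n. Qed.

Lemma mnm2_le (x y : 'I_q) z : x != y -> (0 < z x)%N -> (0 < z y)%N ->
  (U_(x) + U_(y) <= z)%MM.
Proof.
move=> xy zx zy; apply/mnm_lepP => e; rewrite mnmDE !mnm1E.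
case: (x =P e) => [<-|_]; first by rewrite eq_sym (negPf xy) addn0.
by case: (y =P e) => [<-|].
Qed.

Lemma sumB_gt1 z i : (0 < z (eb i))%N -> (1 < sumB z)%N ->
  exists l, (U_(eb i) + U_(eb l) <= z)%MM.
Proof.
rewrite lt0n -lep1mP => hi h.
have [l hl] : exists l, (U_(eb l) <= z - U_(eb i))%MM.
  by apply: sumB_gt0; move: h; rewrite -{1}(submK hi) !sumE; lia.
exists l; apply/mnm_lepP => x; move/mnm_lepP/(_ x): hi; move/mnm_lepP/(_ x): hl.
by rewrite mnmBE mnmDE; lia.
Qed.

Lemma sumB1 z i l : sumB z = 1%N -> (0 < z (eb i))%N -> z (eb l) = (i == l).
Proof.
rewrite /sumB (bigD1 i) //=; case: eqP => [<-|/eqP il]; first lia.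
by rewrite (bigD1 l) /=; [lia|rewrite eq_sym].
Qed.

Definition Pdiv z := [forall j : 'I_c, ~~ odd j ==> (0 < z (ee j))%N].

Lemma PdivP z : reflect (Pm <= z)%MM (Pdiv z).
Proof.
apply: (iffP forallP) => [H|/mnm_lepP H j]; last first.
  by have := H (ee j); rewrite Pm_ee; case: odd.
apply/mnm_lepP => e; case: (edgeP e) => j; rewrite ?Pm_ea ?Pm_eb // Pm_ee.
by have := H j; case: odd.
Qed.

Lemma Pm_pair_le z i l : Pdiv z -> (U_(eb i) + U_(eb l) <= z)%MM ->
  (Pm + (U_(eb i) + U_(eb l)) <= z)%MM.
Proof.
move=> /PdivP/mnm_lepP hP /mnm_lepP hl; apply/mnm_lepP => e; have := hP e; have := hl e.
by case: (edgeP e) => x; rewrite !mnm_edgeE.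
Qed.

(* The standard monomials for the initial ideal generated by the a_i b_l with
   i < l and the P b_i b_l. *)
Definition nf z :=
  [forall i : 'I_k, forall l : 'I_k, ~~ [&& (i < l)%N, (0 < z (ea i))%N & (0 < z (eb l))%N]]
  && ~~ (Pdiv z && (1 < sumB z)%N).

(** The weight is i + 1 rather than i so that a flip creating a_0 also counts as an increase. *)
Definition wt z : nat := (\sum_(i < k) i.+1 * z (ea i))%N.

Lemma wtD z w : wt (z + w)%MM = (wt z + wt w)%N.
Proof. by rewrite /wt -big_split; apply: eq_bigr => i _; rewrite mnmDE mulnDr. Qed.

Lemma wt_eq z z' : (forall i, z (ea i) = z' (ea i)) -> wt z = wt z'.
Proof. by move=> E; apply: eq_bigr => i _; rewrite E. Qed.

Lemma wt0 : wt 0%MM = 0%N.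
Proof. by rewrite /wt big1 // => i _; rewrite mnm0E muln0. Qed.

Lemma wt_ea i : wt U_(ea i)%MM = i.+1.
Proof.
rewrite /wt (bigD1 i) //= mnm1E eqxx muln1 big1 ?addn0 // => l li.
by rewrite mnm1E eq_ea eq_sym (negPf li) muln0.
Qed.

Lemma mdeg_fiber z z' : vm z = vm z' -> mdeg z = mdeg z'.
Proof. by move=> /(congr1 mdeg); rewrite !mdeg_vmnm; lia. Qed.

(* A representative of the fibre maximising [wt] admits neither of the two
   binomial moves, since both increase [wt]. *)
Lemma nf_exists z : exists2 z', nf z' & vm z' = vm z.
Proof.
have h0 : (mdeg z < (mdeg z).+1)%N by [].
case: (@arg_maxnP _ (BMultinom h0) 
  (fun z' : 'X_{1..q < (mdeg z).+1} => vm z' == vm z)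
  (fun z' : 'X_{1..q < (mdeg z).+1} => wt z')) => //=.
move=> z' /eqP Ez' max.
have {}max w : vm w = vm z' -> (wt w <= wt z')%N.
  move=> E; have hw : (mdeg w < (mdeg z).+1)%N by rewrite (mdeg_fiber (etrans E Ez')).
  by have := max (BMultinom hw); rewrite /= E Ez' eqxx => /(_ isT).
exists (z' : 'X_{1..q}) => //; apply/andP; split.
  apply/forallP => i; apply/forallP => l; apply/negP => /and3P[il zi zl].
  have le : (U_(ea i) + U_(eb l) <= z')%MM by rewrite mnm2_le ?edge_eqE.
  have := esym (vm_swap (z' - (U_(ea i) + U_(eb l)))%MM i l).
  rewrite (submK le) => /max; rewrite -[X in (_ <= wt X)%N](submK le) !wtD !wt_ea.
  rewrite !(@wt_eq U_(eb _)%MM 0%MM) ?wt0; [lia| |]; move=> i'; by rewrite mnm1E eq_eba mnm0E.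
apply/negP => /andP[hP h1]; have [i hi] := sumB_gt0 (ltnW h1).
rewrite lep1mP -lt0n in hi; have [l hl] := sumB_gt1 hi h1.
have le := Pm_pair_le hP hl.
have := esym (vm_flip (z' - (Pm + (U_(eb i) + U_(eb l))))%MM i l).
rewrite (submK le) => /max; rewrite -[X in (_ <= wt X)%N](submK le) !wtD !wt_ea.
rewrite !(@wt_eq U_(eb _)%MM 0%MM) ?wt0; try by move=> i'; rewrite mnm1E eq_eba mnm0E.
by rewrite (@wt_eq Pm 0%MM) ?wt0 => [|i']; [lia|rewrite Pm_ea mnm0E].
Qed.

Lemma sum_neq_lt (f g : 'I_k -> nat) i : (f i < g i)%N ->
  (\sum_l f l = \sum_l g l)%N -> exists l, (g l < f l)%N.
Proof.
move=> lt E; case: (boolP [exists l, (g l < f l)%N]) => [/existsP//|/existsPn nl].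
suff : (\sum_l f l < \sum_l g l)%N by rewrite E ltnn.
rewrite (bigD1 i) // [X in (_ < X)%N](bigD1 i) //= -addSn leq_add //.
by apply: leq_sum => l _; rewrite leqNgt.
Qed.

(** A nonzero multiplicity d in [fiberP] would make one of the two monomials divisible by P and by
    two of the b's. So d = 0 and the a-degrees agree; if the a-exponents still differ, one monomial
    exceeds the other at i and falls short at l, and one of the two then contains a forbidden a
    b. *)
Lemma nf_inj z z' : nf z -> nf z' -> vm z = vm z' -> z = z'.
Proof.
have fw u w (d : int) : nf u -> (0 < d) ->
    (forall j, (u (ee j))%:Z = (w (ee j))%:Z + alt j * d) ->
    (sumA u + sumB u = sumA w + sumB w)%N ->
    (sumA u)%:Z = (sumA w)%:Z - 2 * d -> False.
  move=> /andP[_ /negP nP] d0 E EAB EA; apply: nP; rewrite (_ : (1 < sumB u)%N); last by lia.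
  rewrite andbT; apply/forallP => j; apply/implyP => oj.
  by have := E j; rewrite /alt (negPf oj); lia.
have seg u w i l : nf u -> nf w -> (forall i, (u (ea i) + u (eb i) = w (ea i) + w (eb i))%N) ->
    (u (ea i) < w (ea i))%N -> (w (ea l) < u (ea l))%N -> False.
  move=> /andP[/forallP Nu _] /andP[/forallP Nw _] E hi hl.
  have := E i; have := E l; move=> El Ei.
  have [il|li|/val_inj il] := ltngtP i l; last by move: hl; rewrite -il; lia.
    by move/forallP/(_ l): (Nw i); rewrite il /=; lia.
  by move/forallP/(_ i): (Nu l); rewrite li /=; lia.
move=> nz nz' /fiberP [d [Et Ee EA]].
have EAB := sumAB Et.
have d0 : d = 0.
  have [dn|dp|//] := ltgtP d 0; exfalso.
    apply: (fw z' z (- d)) => //; [lia| |lia].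
    by move=> j; rewrite Ee; ring.
  exact: (fw z z' d).
have EA' : sumA z = sumA z' by lia.
have ltF u w i : nf u -> nf w -> (forall i, (u (ea i) + u (eb i) = w (ea i) + w (eb i))%N) ->
    sumA u = sumA w -> (u (ea i) < w (ea i))%N -> False.
  by move=> nu nw E ES lt; have [l hl] := sum_neq_lt lt ES; apply: (seg u w i l).
have Ea i : z (ea i) = z' (ea i).
  have [lt|lt|//] := ltngtP (z (ea i)) (z' (ea i)); exfalso.
    exact: (ltF z z' i).
  by apply: (ltF z' z i).
apply: eq_mnm_edge => // [i|j]; first by have := Et i; rewrite Ea; lia.
by have := Ee j; rewrite d0 mulr0 addr0 => -[].
Qed.

(* The standard monomials of the graph with only t_0, ..., t_(m-1). *)
Definition nfk (m : nat) z :=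
  nf z && [forall i : 'I_k, (m <= i)%N ==> (z (ea i) == 0)%N && (z (eb i) == 0)%N].

Lemma nfkP m z : reflect
  [/\ forall i l : 'I_k, (i < l)%N -> (0 < z (ea i))%N -> (0 < z (eb l))%N -> False,
      (forall j : 'I_c, ~~ odd j -> (0 < z (ee j))%N) -> (sumB z <= 1)%N
    & forall i : 'I_k, (m <= i)%N -> z (ea i) = 0%N /\ z (eb i) = 0%N] (nfk m z).
Proof.
apply: (iffP andP) => [[/andP[/forallP N1 N2] /forallP N3]|[N1 N2 N3]].
  split=> [i l il zi zl|HP|i mi].
  - by move/forallP/(_ l): (N1 i); rewrite il zi zl.
  - rewrite leqNgt; apply: contra N2 => ->; rewrite andbT; apply/forallP => j.
    by apply/implyP; apply: HP.
  - by have := N3 i; rewrite mi => /andP[/eqP -> /eqP ->].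
split; last by apply/forallP => i; apply/implyP => /N3[-> ->].
apply/andP; split.
  by apply/forallP => i; apply/forallP => l; apply/negP => /and3P[]; apply: N1.
apply/negP => /andP[/forallP HP]; rewrite ltnNge => /negP; apply; apply: N2 => j.
by move: (HP j) => /implyP.
Qed.

Lemma nfkk : nfk k =1 nf.
Proof.
move=> z; rewrite /nfk; case: nf => //=; apply/forallP => i.
by rewrite leqNgt ltn_ord.
Qed.

Definition freeBE (m : nat) : {set 'I_q} :=
  [set e | match split e with
           | inl f => if split f is inr i then (i < m)%N else false
           | inr _ => true
           end].

Lemma freeBE_ea m i : (ea i \in freeBE m) = false.
Proof. by rewrite inE !(unsplitK (inl _)). Qed.
Lemma freeBE_eb m i : (eb i \in freeBE m) = (i < m)%N.
Proof. by rewrite inE (unsplitK (inl _)) (unsplitK (inr _)). Qed.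
Lemma freeBE_ee m j : ee j \in freeBE m.
Proof. by rewrite inE (unsplitK (inr _)). Qed.

Lemma sum_ltn m N : (m <= N)%N -> (\sum_(i < N) (i < m) = m)%N.
Proof.
elim: N m => [|N IH] [|m] mN; rewrite ?big_ord0 ?big_ord_recl //=.
  by rewrite big1.
by rewrite add1n; congr _.+1; apply: IH.
Qed.

Lemma card_freeBE m : (m <= k)%N -> #|freeBE m| = (m + c)%N.
Proof.
move=> mk; rewrite -sum1_card big_mkcond sum_edge big1 ?add0n; last first.
  by move=> i _; rewrite freeBE_ea.
congr (_ + _)%N.
  rewrite -[RHS](sum_ltn mk); apply: eq_bigr => i _; rewrite freeBE_eb.
  by case: ltnP.
rewrite -[RHS](card_ord c) -sum1_card; apply: eq_bigr => j _.
by rewrite freeBE_ee.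
Qed.

Fixpoint hpoly (m : nat) : {poly int} :=
  if m is m'.+1 then
    hpoly m' + \sum_(i < s.+3) 'X^(i.+1) + (1 - 'X) ^+ m' * 'X^(s.+4)
  else 1.

Lemma geometric N :
  (1 - 'X) * \sum_(i < N) 'X^(i.+1) = 'X - 'X^(N.+1) :> {poly int}.
Proof.
elim: N => [|N IH]; first by rewrite big_ord0 mulr0 expr1 subrr.
by rewrite big_ord_recr /= mulrDr IH (exprS _ N.+1); ring.
Qed.

Lemma boxE z0 m z : (forall i, z0 (ea i) = 0%N) -> box z0 (freeBE m) z =
  [&& [forall i : 'I_k, z (ea i) == 0%N],
   [forall i : 'I_k, (z0 (eb i) <= z (eb i))%N && ((i < m)%N || (z (eb i) == z0 (eb i)))] &
   [forall j : 'I_c, (z0 (ee j) <= z (ee j))%N]].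
Proof.
move=> z0a; apply/boxP/and3P => [H|[/forallP HA /forallP HB /forallP HE] e].
  split; apply/forallP => i.
  - by have [_ ->] := H (ea i); rewrite ?freeBE_ea ?z0a.
  - have [-> h] := H (eb i); case: ltnP => //= mi.
    by rewrite h ?freeBE_eb // -leqNgt.
  - by have [] := H (ee i).
case: (edgeP e) => i.
- by rewrite z0a (eqP (HA i)).
- by have /andP[h1 /orP[h2|/eqP h2]] := HB i; split; rewrite // freeBE_eb ?h2.
- by rewrite freeBE_ee; split.
Qed.

Lemma boxbP i z : reflect [/\ forall l, z (ea l) = 0%N, (0 < z (eb i))%N &
    forall l : 'I_k, (i < l)%N -> z (eb l) = 0%N] (box U_(eb i)%MM (freeBE i.+1) z).
Proof.
rewrite boxE; last by move=> l; rewrite !mnm_edgeE.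
apply: (iffP and3P).
  move=> [/forallP HA /forallP HB _]; split=> [l||l il]; first exact/eqP.
    by have := HB i; rewrite mnm1E eqxx => /andP[].
  have /andP[_] := HB l; rewrite !mnm_edgeE ltnS leqNgt il /= => /eqP ->.
  by case: eqP il => // <- /=; rewrite ltnn.
move=> [HA HB HC]; split; apply/forallP => l; rewrite ?HA ?mnm_edgeE //.
case: eqP => [<-|]; first by rewrite HB ltnSn.
by rewrite leq0n ltnS /=; case: leqP => //= /HC ->.
Qed.

Lemma boxb_Pm i z : box (U_(eb i) + Pm)%MM (freeBE 0) z =
  box U_(eb i)%MM (freeBE i.+1) z && ((sumB z == 1%N) && Pdiv z).
Proof.
have Pe : Pdiv z = [forall j : 'I_c, ((U_(eb i) + Pm)%MM (ee j) <= z (ee j))%N].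
  by apply: eq_forallb => j; rewrite !mnm_edgeE; case: odd.
rewrite boxE -?Pe; last by move=> l; rewrite !mnm_edgeE.
rewrite !andbA; congr (_ && _).
apply/andP/andP => [[/forallP HA /forallP HB]|[/boxbP[HA HB HC] /eqP S1]].
  have HB0 l : z (eb l) = (i == l).
    by have := HB l; rewrite !mnm_edgeE /= => /andP[_ /eqP].
  have S1 : sumB z = 1%N by rewrite -[RHS](sum_pred1 i); apply: eq_bigr => l _.
  rewrite S1; split=> //; apply/boxbP; split=> [l||l il]; first exact/eqP.
    by rewrite HB0 eqxx.
  by rewrite HB0; case: eqP il => // <- /=; rewrite ltnn.
split; apply/forallP => l; rewrite ?HA // !mnm_edgeE /=.
by rewrite (sumB1 l S1 HB) leqnn eqxx.
Qed.

Lemma boxb_Pdiv i z : box (U_(eb i) + Pm)%MM (freeBE i.+1) z =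
  box U_(eb i)%MM (freeBE i.+1) z && Pdiv z.
Proof.
rewrite !boxE; try by move=> l; rewrite !mnm_edgeE.
have -> : [forall j : 'I_c, (U_(eb i)%MM (ee j) <= z (ee j))%N].
  by apply/forallP => j; rewrite !mnm_edgeE.
rewrite andbT -andbA; congr [&& _, _ & _].
  by apply: eq_forallb => l; rewrite !mnm_edgeE.
by apply: eq_forallb => j; rewrite !mnm_edgeE; case: odd.
Qed.

Lemma HS_nfk m : (m <= k)%N -> HS (nfk m) (m + c) (hpoly m).
Proof.
elim: m => [|m IH] mk.
  have := HS_box (0%MM : 'X_{1..q}) (freeBE 0).
  rewrite card_freeBE // mdeg0 expr0; apply: HS_ext => z.
  rewrite boxE; last by move=> i; rewrite mnm0E.
  apply/idP/nfkP => [/and3P[/forallP HA /forallP HB /forallP HE]|[N1 N2 N3]].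
    have HB0 i : z (eb i) = 0%N.
      by have := HB i; rewrite mnm0E ltn0 => /eqP.
    split=> [i l _|_|i _]; first by rewrite HB0.
      by rewrite /sumB big1.
    by rewrite HB0 (eqP (HA i)).
  apply/and3P; split; apply/forallP => i; rewrite ?mnm0E //.
    by have [->] := N3 i isT.
  by have [_ ->] := N3 i isT.
pose im : 'I_k := Ordinal mk.
have {}IH := IH (ltnW mk).
(* Since no b_l with l > m is left, multiplying by a_m keeps monomials standard. *)
rewrite addSn; apply: (@HS_toggle _ _ (ea im)).
  move=> z /nfkP[N1 N2 N3]; apply/nfkP; split=> [i l il|HP|i mi].
  - rewrite !mnm_edgeE; case: eqP => [E _|_]; last by rewrite addn0; apply: N1.
    have ml : (m < l)%N by move: il; rewrite -E.
    by have [_ ->] := N3 l ml.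
  - rewrite !sumE addn0; apply: N2 => j oj.
    by have := HP j oj; rewrite !mnm_edgeE.
  - rewrite !mnm_edgeE; have [-> ->] := N3 i mi.
    by split=> //; case: eqP mi => // <- /=; rewrite ltnn.
pose D1 z := nfk m.+1 z && (z (ea im) == 0%N).
apply: (@HS_ext _ D1).
  move=> z; rewrite /D1; case nz : (nfk m.+1 z) => //=.
  case: (posnP (z (ea im))) => [_|z0] //=; apply/esym/negbTE.
  rewrite negbK; case/nfkP: nz => N1 N2 N3; apply/nfkP; split=> [i l il|HP|i mi].
  - by rewrite !mnmBE => zi zl; apply: (N1 i l il); [move: zi|move: zl]; lia.
  - have -> : sumB (z - U_(ea im))%MM = sumB z.
      by apply: eq_bigr => i _; rewrite mnmBE !mnm_edgeE subn0.
    by apply: N2 => j oj; have := HP j oj; rewrite mnmBE; lia.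
  - by rewrite !mnmBE; have [-> ->] := N3 i mi.
rewrite -/hpoly /= -addrA.
(* With a_m gone, the monomials free of b_m are those of the smaller graph; the multiples of b_m
   account for the multiples of t_m. *)
apply: (@HS_union _ _ (fun z => z (eb im) == 0%N)).
  apply: HS_ext IH => z; rewrite /D1; apply/nfkP/andP => [[N1 N2 N3]|[/andP[/nfkP[N1 N2 N3]] ]].
    have [-> ->] := N3 im (leqnn _); split=> //; rewrite andbT; apply/nfkP; split=> // i mi.
    by apply: N3; apply: ltnW.
  move=> /eqP za /eqP zb; split=> // i; rewrite leq_eqVlt => /orP[/eqP E|]; last exact: N3.
  by have -> : i = im; [apply/val_inj/esym|].
pose V := box U_(eb im)%MM (freeBE m.+1).
have VP := boxbP im.
have DV z : D1 z && (z (eb im) != 0%N) = V z && (Pdiv z ==> (sumB z <= 1)%N).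
  apply/andP/andP => [[/andP[/nfkP[N1 N2 N3] /eqP za]]|[/VP[HA HB HC] /implyP HP]].
    rewrite -lt0n => zb; split; last by apply/implyP => /PdivP/mnm_lepP hP; apply: N2 => j oj;
      have := hP (ee j); rewrite Pm_ee oj.
    apply/VP; split=> // [i|i mi]; last by have [_ ->] := N3 i mi.
    have [im'|mi|/val_inj->//] := ltngtP i im; last by have [->] := N3 i mi.
    by apply/eqP; rewrite -leqn0 leqNgt; apply/negP => zi; apply: (N1 i im).
  rewrite -lt0n; split=> //; rewrite /D1 HA eqxx andbT; apply/nfkP; split=> [i l _|hP|i mi].
  - by rewrite HA.
  - apply: HP; apply/PdivP/mnm_lepP => e; case: (edgeP e) => j; rewrite ?Pm_ea ?Pm_eb // Pm_ee.
    by case oj: (odd j) => //=; apply: hP; rewrite oj.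
  - by rewrite HA HC.
have V1 z : V z -> (0 < sumB z)%N.
  by case/VP => _ h _; rewrite /sumB (bigD1 im) //= ltn_addr.
pose U1 z := (sumB z == 1%N) && Pdiv z.
(* The multiples of b_m divisible by P contain no second b: they are b_m P times a monomial in the
   cycle edges. Having m fewer free variables costs the factor (1 - x)^m. *)
rewrite addrC; apply: (@HS_union _ _ U1).
  have := HS_box (U_(eb im) + Pm)%MM (freeBE 0).
  rewrite card_freeBE // mdegD mdeg1 mdeg_Pm => /(@HS_raise _ _ _ m _).
  apply: HS_ext => z; rewrite DV boxb_Pm -andbA -/(V z); congr (_ && _).
  by rewrite /U1; case: eqP => [->|]; rewrite ?andbF //= implybT.
(* Those not divisible by P have series (x - x^(s+4)) / (1 - x)^(m+1+c); cancelling one factor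
   leaves the geometric sum. *)
apply: HS_lower; rewrite geometric.
apply: (@HS_ext _ (fun z => V z && ~~ Pdiv z)).
  move=> z; rewrite DV /U1; case: (boolP (V z)) => //= /V1 S0.
  by case: (Pdiv z) => //=; rewrite ?andbT ?andbF //; lia.
apply: HS_diff.
  by have := HS_box U_(eb im)%MM (freeBE m.+1); rewrite card_freeBE // mdeg1 expr1.
have := HS_box (U_(eb im) + Pm)%MM (freeBE m.+1).
rewrite card_freeBE // mdegD mdeg1 mdeg_Pm; apply: HS_ext => z.
exact: boxb_Pdiv.
Qed.

End NormalForms.

(** * The h-polynomial of the graph and its minimal generator of degree r + 1 *)

Section Bicycle.

Variables (K : fieldType) (s k : nat).

Local Notation c := s.*2.+4.+2.
Local Notation n := (c + k)%N.
Local Notation q := (k + k + c)%N.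
Local Notation vm := (vmnm (@bicycle s k)).
Local Notation ea := (ea s).
Local Notation eb := (eb s).
Local Notation ee := (@ee s k).
Local Notation em := (edge_monomials K (@bicycle s k)).
Local Notation I := (@toric_ideal K n q (@bicycle s k)).
Local Notation Pm := (@Pm s k).
Local Notation Qm := (@Qm s k).
Local Notation mnm_edgeE :=
  (mnmDE, mnm1E, (@edge_eqE s k), (@Pm_ee s k), (@Pm_ea s k), (@Pm_eb s k),
   (@Qm_ee s k), (@Qm_ea s k), (@Qm_eb s k), addn0, add0n).

(** Standard monomials have distinct images under the toric map and meet every fibre, so coordinates
    modulo the ideal are coefficients of the image. *)
Lemma hilbert_fun_bicycle d : hilbert_fun_is I d (cnt (@nf s k) d).
Proof.
pose A := [set z : 'X_{1..q < d.+1} | (mdeg z == d) && nf z].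
pose zt (t : 'I_(cnt (@nf s k) d)) : 'X_{1..q} := enum_val (t : 'I_#|A|).
have zA t : mdeg (zt t) = d /\ nf (zt t).
  by have := enum_valP (t : 'I_#|A|); rewrite inE => /andP[/eqP].
have zinj t u : vm (zt t) = vm (zt u) -> t = u.
  by move/(nf_inj (zA t).2 (zA u).2)/val_inj/enum_val_inj.
have coefE (a : 'I_(cnt (@nf s k) d) -> K) t :
    ((\sum_u a u *: 'X_[zt u]) \mPo em)@_(vm (zt t)) = a t.
  rewrite (raddf_sum (comp_mpoly em)) (raddf_sum (mcoeff (vm (zt t)))) /= (bigD1 t) //=.
  rewrite comp_mpolyZ mcoeffZ comp_edgeX mcoeffX eqxx mulr1 big1 ?addr0 // => u ut.
  rewrite comp_mpolyZ mcoeffZ comp_edgeX mcoeffX; case: eqP => [/zinj E|]; rewrite ?mulr0 //.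
  by rewrite E eqxx in ut.
exists (fun t => 'X_[zt t]); split; [|split].
- by move=> t; rewrite dhomogX; apply/eqP; have [] := zA t.
- move=> a /eqP a0 t; rewrite -(coefE a t); rewrite a0; exact: mcoeff0.
move=> p hp; exists (fun t => (p \mPo em)@_(vm (zt t))).
rewrite /toric_ideal /=; apply/eqP/mpolyP => v; rewrite mcoeff0 raddfB /= mcoeffB.
apply/eqP; rewrite subr_eq0; apply/eqP.
have [[t ->]|nt] : (exists t, v = vm (zt t)) \/ ~ (exists t, v = vm (zt t)).
  have [/existsP[t /eqP->]|/existsPn nt] := boolP [exists t, v == vm (zt t)].
    by left; exists t.
  by right=> -[t E]; have := nt t; rewrite E eqxx.
- by rewrite coefE.
transitivity (0 : K).
  apply/eqP; apply/contraT => /mcoeff_comp_neq0 [m mp Em].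
  case: nt; have [z' nz Ez'] := nf_exists m.
  have dz : mdeg z' = d by rewrite (mdeg_fiber Ez') (dhomog_mf hp mp).
  have hz : (mdeg z' < d.+1)%N by rewrite dz.
  have zA' : BMultinom hz \in A by rewrite inE /= dz eqxx.
  exists (enum_rank_in zA' (BMultinom hz)).
  by rewrite -Em -Ez' /zt enum_rankK_in.
rewrite (raddf_sum (comp_mpoly em)) (raddf_sum (mcoeff v)) /= big1 // => u _.
rewrite comp_mpolyZ mcoeffZ comp_edgeX mcoeffX; case: eqP => [E|]; rewrite ?mulr0 //.
by case: nt; exists u.
Qed.

(** At 1 the power of 1 - x survives only in the first step of the recursion, where its exponent is
    0; hence the boolean summand. *)
Lemma horner_hpoly m : (hpoly s m).[1] = 1 + (m * s.+3 + (0 < m))%:Z.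
Proof.
elim: m => [|m IH]; first by rewrite /= hornerC.
have h1X : (1 - 'X : {poly int}).[1] = 0 by rewrite !hornerE subrr.
rewrite [hpoly s m.+1]/= 2!hornerD hornerM horner_exp hornerXn horner_sum IH h1X expr1n mulr1.
rewrite (eq_bigr (fun=> 1)) => [|i _]; last by rewrite hornerXn expr1n.
rewrite sumr_const card_ord natz.
by case: m {IH} => [|m]; rewrite ?expr0 ?expr0n /=; lia.
Qed.

(** The last summand (1 - x)^m x^(s+4) has degree above all the others, so nothing cancels and each
    step raises the degree by one. *)
Lemma size_hpoly m : size (hpoly s m.+1) = (s + 5 + m)%N.
Proof.
have s1 : size (1 - 'X : {poly int}) = 2%N by rewrite -opprB size_polyN size_XsubC.
have sT l : size ((1 - 'X) ^+ l * 'X^(s.+4) : {poly int}) = (s + 5 + l)%N.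
  have nz : (1 - 'X : {poly int}) ^+ l != 0.
    by rewrite expf_neq0 // -size_poly_gt0 s1.
  have := size_exp (1 - 'X : {poly int}) l; rewrite s1 mul1n.
  have : (0 < size ((1 - 'X : {poly int}) ^+ l))%N by rewrite size_poly_gt0.
  by rewrite size_mulXn // => h1 h2; rewrite -(prednK h1) h2; lia.
have sS : leq (size (\sum_(i < s.+3) 'X^(i.+1) : {poly int})) (s + 4)%N.
  apply: (leq_trans (size_sum _ _ _)); apply/bigmax_leqP => i _.
  by rewrite size_polyXn; have := ltn_ord i; lia.
have step l : (size (hpoly s l) <= s + 4 + l)%N -> size (hpoly s l.+1) = (s + 5 + l)%N.
  move=> sh; rewrite /= addrC size_polyDl // sT.
  apply: (leq_ltn_trans (size_polyD _ _)); rewrite gtn_max.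
  apply/andP; split; [apply: (leq_ltn_trans sh)|apply: (leq_ltn_trans sS)]; lia.
apply: (step m); elim: m => [|m IH]; first by rewrite size_poly1; lia.
by rewrite (step m IH); lia.
Qed.

Lemma h_polynomial_bicycle : h_polynomial_is I (hpoly s k).
Proof.
split; first by rewrite horner_hpoly; lia.
(* The exponent is the number of vertices. *)
exists (k + c)%N, (cnt (@nf s k)); split; first exact: hilbert_fun_bicycle.
move=> d; rewrite -(HS_ext (@nfkk s k) (@HS_nfk s k k (leqnn _))).
exact: iter_difE.
Qed.

Lemma fiber1_mcoeff (p : {mpoly K[q]}) z : (forall z', vm z' = vm z -> z' = z) ->
  I p -> p@_z = 0.
Proof.
move=> uz /eqP /(congr1 (mcoeff (vm z))); rewrite mcoeff0 mcoeff_comp_edge.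
have [zp|zp] := boolP (z \in msupp p); last by rewrite memN_msupp_eq0.
rewrite -big_filter (bigD1_seq z) ?mem_filter ?filter_uniq ?msupp_uniq ?eqxx ?zp //=.
rewrite big_seq_cond big1 ?addr0 // => m /andP[]; rewrite mem_filter.
by move=> /andP[/eqP /uz -> _]; rewrite eqxx.
Qed.

(** Removing any one variable from P b_0^2 destroys its only flip, and without a's there is no swap
    or reverse flip. Hence this monomial cannot occur in the maximal ideal times I_G. *)
Lemma fiber1_Pm i0 e (z := (Pm + (U_(eb i0) + U_(eb i0)))%MM) :
  (U_(e) <= z)%MM -> forall z', vm z' = vm (z - U_(e))%MM -> z' = (z - U_(e))%MM.
Proof.
set nu := (z - U_(e))%MM => ez z' /fiberP[d [Et Ee EA]].
have nuz : (nu + U_(e) = z)%MM by rewrite submK.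
have A0 i : nu (ea i) = 0%N by rewrite mnmBE /z !mnm_edgeE.
have SA : sumA nu = 0%N by rewrite /sumA big1.
have SB : sumB nu = (2 - sumB U_(e)%MM)%N.
  by move: (congr1 (@sumB s k) nuz); rewrite /z !sumE; lia.
have EAB := sumAB Et.
have d0 : d = 0.
  have [dn|dp|//] := ltgtP d 0; last by exfalso; lia.
  exfalso; move: ez nuz SB; rewrite lep1mP; case: (edgeP e) => x.
  - by rewrite /z !mnm_edgeE.
  - by rewrite !sumE; lia.
  rewrite /z !mnm_edgeE => ox nuz _; have := Ee x; rewrite /alt.
  have : nu (ee x) = 0%N.
    have := congr1 (fun z : 'X_{1..q} => z (ee x)) nuz; rewrite /= !mnm_edgeE eqxx; lia.
  by case: (odd x) ox => //= _ ->; lia.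
have SA' : sumA z' = 0%N by lia.
have A0' i : z' (ea i) = 0%N.
  by apply/eqP; move/eqP: SA'; rewrite /sumA sum_nat_eq0 => /forallP /(_ i).
apply: eq_mnm_edge => [i|i|j]; first by rewrite A0 A0'.
  by have := Et i; rewrite A0 A0'.
by have := Ee j; rewrite d0 mulr0 addr0 => -[].
Qed.

(* The class of the minimal generator P b_0^2 - Q a_0^2. *)
Lemma betti_bicycle : (0 < k)%N -> betti_nonzero I 1 s.+3.+2.
Proof.
move=> k0; pose i0 : 'I_k := Ordinal k0; split=> //.
pose p0 := ee (vx s); pose q0 := ee (inord 1).
pose zP := (Pm + (U_(eb i0) + U_(eb i0)))%MM.
pose zQ := (Qm + (U_(ea i0) + U_(ea i0)))%MM.
have pP : (U_(p0) <= zP)%MM by rewrite lep1mP /zP !mnm_edgeE /vx inordK.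
have qQ : (U_(q0) <= zQ)%MM by rewrite lep1mP /zQ !mnm_edgeE inordK.
have pq : p0 != q0 by rewrite eq_ee -(inj_eq val_inj) /= !inordK.
have vPQ : vm zP = vm zQ.
  by rewrite -[zP]add0m -[zQ]add0m vm_flip.
have dP : mdeg zP = s.+3.+2 by rewrite /zP !mdegD mdeg_Pm !mdeg1 addn2.
have dQ : mdeg zQ = s.+3.+2 by rewrite -(mdeg_fiber vPQ).
have mdegB1 (z : 'X_{1..q}) e d : (U_(e) <= z)%MM -> mdeg z = d.+1 -> mdeg (z - U_(e))%MM = d.
  by move=> /submK {1}<-; rewrite mdegD mdeg1 addn1 => -[].
(* Writing P b_0^2 and Q a_0^2 as multiples of p0 and q0 lifts their difference to a 1-chain. *)
pose ch (S : {set 'I_q}) : {mpoly K[q]} :=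
  if S == [set p0] then 'X_[zP - U_(p0)] else if S == [set q0] then - 'X_[zQ - U_(q0)] else 0.
have inc0 (x : nat) : #|[set l in (set0 : {set 'I_q}) | (l < x)%N]| = 0%N.
  by apply/eqP; rewrite cards_eq0; apply/eqP/setP => y; rewrite !inE.
have ch0 : koszul_d ch set0 = 'X_[zP] - 'X_[zQ].
  rewrite /koszul_d (bigD1 p0) ?inE //= (bigD1 q0) ?inE ?(eq_sym q0) //=.
  rewrite big1 ?addr0 => [|x /andP[/andP[_ xp] xq]].
    rewrite !inc0 !expr0 !mul1r !setU0 /ch eqxx (inj_eq set1_inj) (eq_sym q0) (negPf pq) eqxx.
    by rewrite mulrN -!mpolyXD ![(U_(_) + _)%MM]addmC !submK.
  by rewrite setU0 /ch !(inj_eq set1_inj) (negPf xp) (negPf xq) mulr0.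
exists ch; split; [|split; [|split]].
- move=> S _; rewrite /ch subn1; case: eqP => _.
    by rewrite dhomogX; apply/eqP; apply: mdegB1 dP.
  case: eqP => _; last exact: rpred0.
  by rewrite rpredN dhomogX; apply/eqP; apply: mdegB1 dQ.
- move=> S S1; rewrite /ch; case: eqP => [E|_]; first by rewrite E cards1 in S1.
  by case: eqP => [E|_] //; rewrite E cards1 in S1.
- move=> T; have [->|/set0Pn[x xT]] := eqVneq T set0.
    by rewrite ch0 /toric_ideal /= raddfB /= !comp_edgeX vPQ subrr.
  rewrite /koszul_d big1; first by rewrite /toric_ideal /= comp_mpoly0.
  move=> y yT; have nS w : (y |: T == [set w]) = false.
    apply/negbTE; apply: contraNneq yT => E.
    have : y \in [set w] by rewrite -E setU11.
    have : x \in [set w] by rewrite -E !inE xT orbT.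
    by rewrite !inE => /eqP xw /eqP ->; rewrite -xw.
  by rewrite /ch !nS mulr0.
case=> b [_ bI].
(* If [ch] bounds, then [f] has entries in the ideal and the same boundary as [ch]. At P b_0^2 the
   coefficient of that boundary would be both 1 and 0. *)
pose f S := ch S - koszul_d b S.
have E : koszul_d ch set0 = koszul_d f set0.
  have := bdryB (fun i : 'I_q => ('X_i : {mpoly K[q]})) ch (koszul_d b) set0.
  have := bdry_bdry (fun i : 'I_q => ('X_i : {mpoly K[q]})) b set0.
  rewrite -/(koszul_d (koszul_d b) set0) => ->; rewrite subr0.
  by move=> h; apply/esym/h.
have := congr1 (mcoeff zP) E; rewrite ch0 mcoeffB !mcoeffX eqxx.
have -> : (zQ == zP) = false.
  apply/negbTE/eqP => /(congr1 (fun z : 'X_{1..q} => z (ea i0))) /=.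
  by rewrite /zP /zQ !mnm_edgeE eqxx.
rewrite subr0 /koszul_d (raddf_sum (mcoeff zP)) /= big1 => [/eqP|x _]; first by rewrite oner_eq0.
rewrite -mulrA inc0 expr0 mul1r mcoeffXM; case: ifP => // xP.
by apply: (fiber1_mcoeff (fiber1_Pm xP)); apply: bI.
Qed.

End Bicycle.

(** * Vanishing of high Koszul homology *)

Section Vanishing.

Variables (K : fieldType) (s k : nat) (v : 'X_{1..s.*2.+4.+2 + k}) (i j : nat).

Local Notation c := s.*2.+4.+2.
Local Notation n := (c + k)%N.
Local Notation q := (k + k + c)%N.
Local Notation G := (@bicycle s k).
Local Notation vm := (vmnm G).
Local Notation ea := (ea s).
Local Notation eb := (eb s).
Local Notation ee := (@ee s k).
Local Notation Pm := (@Pm s k).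
Local Notation p0 := (ee (vx s)).
Local Notation mnm_edgeE :=
  (mnmDE, mnm1E, (@edge_eqE s k), (@Pm_ee s k), (@Pm_ea s k), (@Pm_eb s k),
   (@Qm_ee s k), (@Qm_ea s k), (@Qm_eb s k), addn0, add0n).

Hypothesis deg_v : mdeg v = j.*2.
Hypothesis deg_ij : (s + 4 < j - i)%N.

Implicit Types (S T : {set 'I_q}) (z : 'X_{1..q}) (l a : 'I_k).

Local Notation D := (strand G v).
Local Notation rep := (srep G v).

Definition fac S z : Prop := vm (z + mesym1 S)%MM = v.

Lemma fac_strand S z : fac S z -> D S.
Proof. by move=> h; apply/strandP; exists z. Qed.

Lemma fac_rep S : D S -> fac S (rep S).
Proof. exact: srepE. Qed.

Lemma facU1 x T z : x \notin T -> fac (x |: T) z <-> fac T (z + U_(x))%MM.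
Proof. by move=> xT; rewrite /fac mesym1U1 // (addmC (mesym1 T)) addmA. Qed.

Lemma fac_fiber S z z' : fac S z -> fac S z' -> vm z = vm z'.
Proof. by rewrite /fac !vmnmD => h h'; apply: (@addIm _ (vm (mesym1 S))); rewrite h h'. Qed.

Lemma fiber_fac S z z' : vm z = vm z' -> fac S z -> fac S z'.
Proof. by rewrite /fac !vmnmD => ->. Qed.

Lemma fac_mdeg S z : fac S z -> (mdeg z + #|S| = j)%N.
Proof.
by move=> h; have := deg_v; rewrite -h mdeg_vmnm mdegD mdeg_mesym1; lia.
Qed.

(* On a family where fibres are singletons, multiplication by the variables in
   [F] acts as on a polynomial ring with generator [z0]; the only critical cells
   are those with factor [z0], whose size is too large to be [i]. *)
Lemma exact_free (N : {set 'I_q} -> bool) (F : {set 'I_q}) z0 :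
  (forall x T, x \in F -> N (x |: T) = N T) ->
  (forall S z z', N S -> box z0 F z -> fac S z -> fac S z' -> z' = z) ->
  (mdeg z0 <= s + 4)%N ->
  convex (fun S => D S && (N S && box z0 F (rep S))) ->
  exact_at K (fun S => D S && (N S && box z0 F (rep S))) i.
Proof.
move=> NF Wu' dz0 cv; pose W S z := N S && box z0 F z.
have Wu S z z' : W S z -> fac S z -> fac S z' -> z' = z.
  by case/andP; apply: Wu'.
have W1 S z : W S z -> (z0 <= z)%MM /\ forall x, x \notin F -> z x = z0 x.
  move=> /andP[_ /boxP H]; split=> [|x]; last by have [] := H x.
  by apply/mnm_lepP => x; have [] := H x.
have Wdel x T z : x \in F -> x \notin T -> W (x |: T) z -> W T (z + U_(x))%MM.
  by move=> xF xT /andP[h1 h2]; rewrite /W -(NF x) // h1 boxD.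
have Wins x T z : x \in F -> x \notin T -> (z0 x <= z x)%N -> W T (z + U_(x))%MM ->
    W (x |: T) z.
  by move=> xF xT zx /andP[h1 h2]; rewrite /W NF // h1 (boxB xF).
set Ga := fun S => _.
have GP S z : fac S z -> W S z -> Ga S /\ rep S = z.
  move=> fz Wz; have h := Wu S z (rep S) Wz fz (fac_rep (fac_strand fz)).
  by rewrite /Ga h (fac_strand fz).
have GW S : Ga S -> fac S (rep S) /\ W S (rep S).
  by move=> /andP[/fac_rep].
have del x T : x \notin T -> Ga T -> Ga (x |: T) -> rep T = (rep (x |: T) + U_(x))%MM.
  move=> xT /GW[fT WT] /GW[/(facU1 _ xT) fx _].
  by rewrite (Wu T _ _ WT fT fx).
(* A free variable can be moved if it lies in S or divides the factor beyond z0. The rank is the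
   position of the first such variable, and each layer is matched by it. *)
pose st S x := (x \in S) || (z0 x < rep S x)%N.
pose rho S := find (st S) (enum F).
have st_eq x T : x \notin T -> Ga T -> Ga (x |: T) -> st T =1 st (x |: T).
  move=> xT GT Gx y; rewrite /st (del x T) // !inE mnmDE mnm1E.
  case: (eqVneq y x) => [->|yx] /=; last by rewrite addn0.
  have [_ /W1[/mnm_lepP /(_ x) h _]] := GW _ Gx.
  by rewrite addn1 ltnS h orbT.
have rho_eq x T : x \notin T -> Ga T -> Ga (x |: T) -> rho T = rho (x |: T).
  by move=> xT GT Gx; apply: eq_find; apply: st_eq.
apply: (exact_rank (rho := rho)) => // [T x GT Gx|m].
  have [xT|xT] := boolP (x \in T); first by rewrite (setUidPr _) ?sub1set.
  by rewrite -rho_eq.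
have [mF|mF] := ltnP m (size (enum F)); last first.
  (* No movable variable means that the factor is z0, so S has j - deg z0 > i elements. *)
  apply: exact_empty => S /andP[GS /eqP rm]; apply/eqP => Si.
  have [fS /W1[z0S nF]] := GW S GS.
  have : ~~ has (st S) (enum F) by rewrite has_find -/(rho S) rm -leqNgt.
  move/hasPn => ns.
  have E : rep S = z0.
    apply/mnmP => x; have [xF|xF] := boolP (x \in F); last exact: nF.
    have := ns x; rewrite mem_enum => /(_ xF); rewrite negb_or -leqNgt => /andP[_ h].
    by apply/eqP; rewrite eqn_leq h; apply: (mnm_lepP z0S).
  by have := fac_mdeg fS; rewrite E; lia.
pose e := tnth (in_tuple (enum F)) (Ordinal mF).
have eF : e \in F by rewrite -mem_enum mem_tnth.
apply: (exact_toggle (e := e)) => S eS.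
have [S1 eS1 ->] : exists2 T : {set 'I_q}, e \notin T & S = e |: T.
  by exists (S :\ e); rewrite ?setD11 // setD1K.
rewrite setU1K //.
apply/andP/andP => [[Gx rx]|[GT rT]].
  have GT : Ga S1.
    have [/(facU1 _ eS1) fx Wx] := GW _ Gx.
    by have [] := GP _ _ fx (Wdel _ _ _ eF eS1 Wx).
  by rewrite (rho_eq e S1).
have [fT WT] := GW _ GT.
have zT : (z0 e < rep S1 e)%N.
  have : st S1 e.
    have hs : has (st S1) (enum F) by rewrite has_find -/(rho S1) (eqP rT).
    have := nth_find e hs; rewrite -/(rho S1) (eqP rT).
    have := tnth_nth e (in_tuple (enum F)) (Ordinal mF).
    by rewrite -/e /= => <-.
  by rewrite /st (negPf eS1).
have eT : (rep S1 - U_(e) + U_(e) = rep S1)%MM.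
  by rewrite submK // lep1mP -lt0n; apply: leq_ltn_trans zT.
have Gx : Ga (e |: S1).
  have [] // := GP (e |: S1) (rep S1 - U_(e))%MM; first by apply/(facU1 _ eS1); rewrite eT.
  by apply: Wins; rewrite ?eT // mnmBE mnm1E eqxx; lia.
by rewrite -(rho_eq e S1).
Qed.

Lemma sumA0 z : sumA z = 0%N -> forall a, z (ea a) = 0%N.
Proof. by move/eqP; rewrite /sumA sum_nat_eq0 => /forallP H a; apply/eqP; apply: (H a). Qed.

(* A fibre containing a monomial free of the [ea] that admits no flip is a
   singleton. *)
Lemma fiber1_noA z z' : (forall a, z (ea a) = 0%N) -> (Pdiv z -> (sumB z <= 1)%N) ->
  vm z' = vm z -> z' = z.
Proof.
move=> A0 HP /fiberP[d [Et Ee EA]].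
have SA : sumA z = 0%N by rewrite /sumA big1.
have EAB := sumAB Et.
have d0 : d = 0.
  have [dn|dp|//] := ltgtP d 0; last by exfalso; lia.
  exfalso; suff /HP : Pdiv z by lia.
  apply/forallP => x; apply/implyP => ox; have := Ee x; rewrite /alt (negPf ox); lia.
have A0' : forall a, z' (ea a) = 0%N by apply: sumA0; lia.
apply: eq_mnm_edge => [a|a|x]; first by rewrite A0 A0'.
  by have := Et a; rewrite A0 A0'.
by have := Ee x; rewrite d0 mulr0 addr0 => -[].
Qed.

(* For a face [S] with complementary factor h: [gam S l] is the exponent of t_l in
   h, [lam S] is the largest l.+1 such that S contains a_l or t_l divides h, and
   [dva S l] says that S contains a_l or a_l divides h. *)
Definition gam S a : nat := (v (vt s a) - smnm G S (vt s a))%N.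

Lemma gamE S z a : fac S z -> gam S a = (z (ea a) + z (eb a))%N.
Proof.
move=> fz; rewrite /gam -{1}(fz : vm (z + mesym1 S)%MM = v).
by rewrite vmnmD mnmDE addnK vmnm_t.
Qed.

Definition act S a := (ea a \in S) || (0 < gam S a)%N.
Definition lam S : nat := (\max_(a | act S a) a.+1)%N.

Lemma lam_eqS S a : lam S = a.+1 <-> act S a /\ forall l, (a < l)%N -> ~~ act S l.
Proof.
split=> [E|[Sa nS]].
  have nS l : (a < l)%N -> ~~ act S l.
    move=> al; apply/negP => Sl; have := @leq_bigmax_cond _ (act S) (fun a => a.+1) l Sl.
    by rewrite -/(lam S) E ltnS leqNgt al.
  split=> //; apply/contraT => Sa; have : (lam S <= a)%N; last by rewrite E ltnn.
  apply/bigmax_leqP => l Sl; rewrite ltn_neqAle.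
  have [al|la|/val_inj E'] := ltngtP l a => //=.
    by rewrite (negPf (nS l la)) in Sl.
  by rewrite E' (negPf Sa) in Sl.
apply/eqP; rewrite eqn_leq (@leq_bigmax_cond _ (act S) (fun a => a.+1)) // andbT.
apply/bigmax_leqP => l Sl; rewrite ltnS leqNgt; apply/negP => /nS.
by rewrite Sl.
Qed.

(** [act] counts a_a both in the face and in the factor, but b_a only in the factor. So passing x
    from the face to the factor can only create activity, and only for x = b_a. *)
Lemma act_del x T a : x \notin T -> D (x |: T) -> act T a = act (x |: T) a || (x == eb a).
Proof.
move=> xT /fac_rep fx; have fT := fx; move/(facU1 _ xT): fT => fT.
rewrite /act (gamE a fx) (gamE a fT) !inE !mnmDE !mnm1E (eq_sym (ea a)).
by case: (ea a \in T); case: (x == ea a); case: (x == eb a) => //=; lia.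
Qed.

Lemma lam_mono T x : D T -> D (x |: T) -> (lam (x |: T) <= lam T)%N.
Proof.
move=> DT Dx; have [xT|xT] := boolP (x \in T); first by rewrite (setUidPr _) ?sub1set.
apply/bigmax_leqP => a Sa; apply: (@leq_bigmax_cond _ (act T) (fun a => a.+1)).
by rewrite (act_del _ xT Dx) Sa.
Qed.

Definition dva S a := (ea a \in S) ||
  [exists z : 'X_{1..q < (mdeg v).+1}, (vm (z + mesym1 S) == v) && (0 < z (ea a))%N].

Lemma dvaP S a : reflect ((ea a \in S) \/ exists2 z, fac S z & (0 < z (ea a))%N) (dva S a).
Proof.
apply: (iffP orP) => [[->|/existsP[z /andP[/eqP fz za]]]|[->|[z fz za]]].
- by left.
- by right; exists z.
- by left.
right; have hz : (mdeg z < (mdeg v).+1)%N by have := fac_mdeg fz; rewrite deg_v; lia.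
by apply/existsP; exists (BMultinom hz); rewrite /= za andbT; apply/eqP.
Qed.

Lemma dva_mono x T a : D T -> D (x |: T) -> dva (x |: T) a -> dva T a.
Proof.
move=> DT Dx; have [xT|xT] := boolP (x \in T); first by rewrite (setUidPr _) ?sub1set.
case/dvaP => [h|[z fz za]]; apply/dvaP.
  move: h; rewrite !inE => /orP[/eqP E|->]; last by left.
  right; exists (rep (x |: T) + U_(x))%MM; first exact/(facU1 _ xT)/fac_rep.
  by rewrite mnmDE mnm1E E eqxx addn1.
right; exists (z + U_(x))%MM; first exact/(facU1 _ xT).
by rewrite mnmDE ltn_addr.
Qed.

(** Moving a_a between face and factor changes no activity, hence not [lam], and the existential in
    [dva] provides a factor from which a_a can be taken. *)
Lemma exact_dva a :
  exact_at K (fun S => (D S && (lam S == a.+1)) && (nat_of_bool (dva S a) == 1%N)) i.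
Proof.
apply: (exact_toggle (e := ea a)) => S eS.
have [T xT ->] : exists2 T : {set 'I_q}, ea a \notin T & S = ea a |: T.
  by exists (S :\ ea a); rewrite ?setD11 // setD1K.
rewrite setU1K //; rewrite !eqb1.
have actE l : D (ea a |: T) -> act T l = act (ea a |: T) l.
  by move=> Dx; rewrite (act_del _ xT Dx) edge_eqE orbF.
apply/andP/andP => [[/andP[Dx /eqP lx] dx]|[/andP[DT /eqP lT] /dvaP]].
  have DT := strand_sub Dx; rewrite (dva_mono DT Dx dx) DT; split=> //=.
  apply/eqP/lam_eqS; move/lam_eqS: lx => [h1 h2].
  by rewrite actE //; split=> // l /h2; rewrite actE.
rewrite (negPf xT) => -[//|[z fz za]].
have Dx : D (ea a |: T).
  apply: (@fac_strand _ (z - U_(ea a))%MM); apply/(facU1 _ xT).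
  by rewrite submK // lep1mP -lt0n.
split; last by rewrite /dva setU11.
rewrite Dx /=; apply/eqP/lam_eqS; move/lam_eqS: lT => [h1 h2].
by rewrite -actE //; split=> // l /h2; rewrite actE.
Qed.

Definition noA (m : nat) S := [forall a : 'I_k, (m <= a)%N ==> (ea a \notin S)].

Lemma noAU1 m x T : (forall a, x != ea a) -> noA m (x |: T) = noA m T.
Proof.
by move=> nx; apply: eq_forallb => a; rewrite !inE eq_sym (negPf (nx a)).
Qed.

(** Here the factor involves cycle edges only: this is the polynomial ring A_0, with critical factor
    1. *)
Lemma exact_lam0 : convex (fun S => D S && (lam S == 0%N)) ->
  exact_at K (fun S => D S && (lam S == 0%N)) i.
Proof.
move=> cv.
pose W S z := noA 0 S && box 0%MM (freeBE s k 0) z.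
have WP S z : reflect ((forall a, ea a \notin S) /\
    forall a, z (ea a) = 0%N /\ z (eb a) = 0%N) (W S z).
  rewrite /W boxE; last by move=> a; rewrite mnm0E.
  apply: (iffP andP) => [[/forallP N /and3P[/forallP HA /forallP HB _]]|[N H]].
    by split=> [a|a]; [have := N a | have := HB a; rewrite mnm0E (eqP (HA a)) => /= /eqP].
  split; first by apply/forallP => a; rewrite N implybT.
  by apply/and3P; split; apply/forallP => a; rewrite ?mnm0E //;
    have [h1 h2] := H a; rewrite ?h1 ?h2.
have Eq S : D S && (lam S == 0%N) = D S && W S (rep S).
  case DS: (D S) => //=; have fS := fac_rep DS.
  apply/eqP/WP => [E|[N H]].
    have na a : ~~ act S a.
      apply/negP => Sa; have := @leq_bigmax_cond _ (act S) (fun a => a.+1) a Sa.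
      by rewrite -/(lam S) E.
    split=> a; have := na a; rewrite /act negb_or => /andP[] //.
    by rewrite (gamE a fS); lia.
  apply/eqP; rewrite -leqn0; apply/bigmax_leqP => a.
  by rewrite /act (negPf (N a)) (gamE a fS); have [-> ->] := H a.
apply: (exact_ext (fsym Eq)).
apply: exact_free.
- by move=> x T xF; apply: noAU1 => a; apply: contraTneq xF => ->; rewrite freeBE_ea.
- move=> S z z' h1 h2 fz fz'.
  have /WP[_ H] : W S z by rewrite /W h1.
  apply: fiber1_noA; last exact: fac_fiber fz' fz.
  + by move=> a; have [] := H a.
  + by move=> _; rewrite /sumB big1 // => a _; have [] := H a.
- by rewrite mdeg0.
exact: convex_ext Eq cv.
Qed.

(* The faces surviving the pairing by a_a: those with factor z = b_a w, where w
   is a monomial in the b_l (l <= a) and the cycle edges, and z is not divisible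
   by any P b_l b_l'. *)
Definition QB a S z :=
  [&& noA a S, box U_(eb a)%MM (freeBE s k a.+1) z & Pdiv z ==> (sumB z <= 1)%N].

Lemma QB_uniq a S z z' : QB a S z -> fac S z -> fac S z' -> z' = z.
Proof.
move=> /and3P[_ /boxbP[HA _ _] /implyP HP] fz fz'.
exact: fiber1_noA HA HP (fac_fiber fz' fz).
Qed.

(** If a_a divides no factor, then no a_l divides one, since a_l b_a could be swapped to a_a b_l;
    nor does P b_a b_l, which flips to Q a_a a_l. *)
Lemma QBE a S : (D S && (lam S == a.+1)) && (nat_of_bool (dva S a) == 0%N) =
  D S && QB a S (rep S).
Proof.
case DS: (D S) => //=; have fS := fac_rep DS; rewrite eqb0.
apply/andP/and3P => [[/eqP/lam_eqS[Sa nS] ndv]|[/forallP N /boxbP[HA HB HC] /implyP HP]].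
  have aS : ea a \notin S by apply: contra ndv => h; apply/dvaP; left.
  have fa z : fac S z -> z (ea a) = 0%N.
    move=> fz; apply/eqP; rewrite -leqn0 leqNgt; apply: contra ndv => za.
    by apply/dvaP; right; exists z.
  have ba : (0 < rep S (eb a))%N.
    by move: Sa; rewrite /act (negPf aS) (gamE a fS) fa.
  have HA l : rep S (ea l) = 0%N.
    have [->|la] := eqVneq l a; first exact: fa.
    apply/eqP; rewrite -leqn0 leqNgt; apply/negP => zl.
    have le : (U_(ea l) + U_(eb a) <= rep S)%MM by rewrite mnm2_le ?edge_eqE.
    have E := vm_swap (rep S - (U_(ea l) + U_(eb a)))%MM l a.
    rewrite (submK le) in E; have := fa _ (fiber_fac E fS).
    by rewrite !mnm_edgeE eqxx; lia.
  split.
  - apply/forallP => l; apply/implyP; rewrite leq_eqVlt => /orP[/eqP/val_inj<-//|al].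
    by have := nS l al; rewrite /act negb_or => /andP[].
  - apply/boxbP; split=> // l al; have := nS l al.
    by rewrite /act negb_or (gamE l fS) => /andP[_]; lia.
  apply/implyP => hP; rewrite leqNgt; apply/negP => /(sumB_gt1 ba)[l le1].
  have le := Pm_pair_le hP le1.
  have E := vm_flip (rep S - (Pm + (U_(eb a) + U_(eb l))))%MM a l.
  rewrite (submK le) in E; have := fa _ (fiber_fac E fS).
  by rewrite !mnm_edgeE eqxx; lia.
split.
  apply/eqP/lam_eqS; split; first by rewrite /act (gamE a fS) HA HB orbT.
  move=> l al; rewrite /act (gamE l fS) HA HC // orbF.
  by have := N l; rewrite (ltnW al).
apply/negP => /dvaP[h|[z fz za]]; first by have := N a; rewrite leqnn h.
by move: za; rewrite (fiber1_noA HA HP (fac_fiber fz fS)) HA.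
Qed.

Lemma QB_rep a S z : fac S z -> QB a S z -> D S && QB a S (rep S) /\ rep S = z.
Proof.
move=> fz Qz; have DS := fac_strand fz.
by have E := QB_uniq Qz fz (fac_rep DS); rewrite DS E.
Qed.

Lemma QB_del a x T : x \notin T -> D T && QB a T (rep T) ->
  D (x |: T) && QB a (x |: T) (rep (x |: T)) -> rep T = (rep (x |: T) + U_(x))%MM.
Proof.
move=> xT /andP[/fac_rep fT QT] /andP[/fac_rep /(facU1 _ xT) fx _].
by rewrite (QB_uniq QT fT fx).
Qed.

Lemma ea_notin_free (m : nat) x : x \in freeBE s k m -> forall l, x != ea l.
Proof. by move=> xF l; apply: contraTneq xF => ->; rewrite freeBE_ea. Qed.

Lemma PdivD z z' : Pdiv z -> Pdiv (z + z')%MM.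
Proof. by move=> /PdivP h; apply/PdivP; apply: lepm_trans h (lem_addr _ _). Qed.

Lemma exact_QB a : convex (fun S => D S && QB a S (rep S)) ->
  exact_at K (fun S => D S && QB a S (rep S)) i.
Proof.
set G2 := fun S => _ => cv.
have ext_mono (rho : {set 'I_q} -> nat) (H : {set 'I_q} -> bool) :
    (forall T x, x \notin T -> H T -> H (x |: T) -> (rho (x |: T) <= rho T)%N) ->
    forall T x, H T -> H (x |: T) -> (rho (x |: T) <= rho T)%N.
  move=> h T x HT Hx; have [xT|xT] := boolP (x \in T); last exact: h.
  by rewrite (setUidPr _) ?sub1set.
(* When P divides the factor, b_a is its only b, and the cycle edges alone stay free. *)
pose R1 S := nat_of_bool ((sumB (rep S) == 1%N) && Pdiv (rep S)).
have R1_mono T x : G2 T -> G2 (x |: T) -> (R1 (x |: T) <= R1 T)%N.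
  apply: (ext_mono R1) => {}T {}x xT GT Gx; rewrite /R1.
  case: (boolP (_ && Pdiv (rep (x |: T)))) => // /andP[/eqP S1 hP].
  have PT : Pdiv (rep T) by rewrite (QB_del xT GT Gx) PdivD.
  have /andP[_ /and3P[_ _]] := GT; rewrite PT /= andbT => S2.
  suff -> : sumB (rep T) = 1%N by [].
  by apply/eqP; rewrite eqn_leq S2 (QB_del xT GT Gx) sumBD S1.
apply: (exact_rank (rho := R1)) => // m.
have cv1 := convex_level (m := m) cv R1_mono.
case: m cv1 => [|[|m]] cv1; last first.
- by apply: exact_empty => S /andP[_]; rewrite /R1; case: (_ && _).
- have Eq S : G2 S && (R1 S == 1%N) =
      D S && (noA a S && box (U_(eb a) + Pm)%MM (freeBE s k 0) (rep S)).
    rewrite /G2 /QB boxb_Pm /R1 eqb1 -!andbA; case: (D S) => //=; congr [&& _, _ & _].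
    by case: eqP => [->|]; rewrite ?andbF //= implybT.
  apply: (exact_ext (fsym Eq)); apply: exact_free.
  + by move=> x T xF; apply: noAU1 => l; apply: ea_notin_free xF l.
  + move=> S z z' NS; rewrite boxb_Pm => /and3P[bz /eqP S1 _]; apply: (@QB_uniq a).
    by rewrite /QB NS bz S1 implybT.
  (* The critical factor b_a P has degree s + 4 = r, the extremal case. *)
  + by rewrite mdegD mdeg1 mdeg_Pm; lia.
  exact: convex_ext Eq cv1.
set G3 := fun S => _ in cv1 *.
have G3E S : G3 S =
    D S && (noA a S && box U_(eb a)%MM (freeBE s k a.+1) (rep S) && ~~ Pdiv (rep S)).
  rewrite /G3 /G2 /QB /R1 eqb0 -!andbA; case: (D S) => //=; case: noA => //=.
  case: boxbP => //= -[_ h _].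
  have : (0 < sumB (rep S))%N by rewrite /sumB (bigD1 a) //= ltn_addr.
  by case: (Pdiv _) => //=; rewrite ?andbT ?andbF //; lia.
have G3_rep S z : fac S z -> noA a S -> box U_(eb a)%MM (freeBE s k a.+1) z ->
    ~~ Pdiv z -> G3 S /\ rep S = z.
  move=> fz NS bz nP.
  have Qz : QB a S z by rewrite /QB NS bz (negPf nP).
  by have [_ E] := QB_rep fz Qz; rewrite G3E E NS bz nP (fac_strand fz).
(* When P does not divide z, pair by the first cycle edge p0; the unpaired faces
   are those involving p0 neither in S nor in z, and those for which p0 * z / P
   is a monomial. *)
pose rho S : nat := if (p0 \notin S) && (rep S p0 == 0%N) then 0%N else
  if [&& p0 \in S, rep S p0 == 0%N & Pdiv (rep S + U_(p0))%MM] then 2%N else 1%N.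
have rho_mono T x : G3 T -> G3 (x |: T) -> (rho (x |: T) <= rho T)%N.
  apply: (ext_mono rho) => {}T {}x xT GT Gx.
  have E : rep T = (rep (x |: T) + U_(x))%MM.
    by case/andP: GT => GT _; case/andP: Gx => Gx _; apply: (QB_del xT GT Gx).
  have nP : ~~ Pdiv (rep T) by move: GT; rewrite G3E => /andP[_ /andP[]].
  rewrite /rho E in nP *; rewrite !inE mnmDE mnm1E (eq_sym p0).
  have [<-|xp] /= := eqVneq x p0.
    by rewrite (negPf nP) andbF addn1 eqn0Ngt /= !andbF.
  rewrite addn0 -addmA (addmC U_(x)%MM) addmA.
  case: (p0 \in T) => /=; case: eqP => //= _.
  have [h|_] := boolP (Pdiv (rep (x |: T) + U_(p0))%MM); [by rewrite PdivD|by case: ifP].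
have p0E e : (e \in freeBE s k a.+1 :\ p0) = (e != p0) && (e \in freeBE s k a.+1).
  by rewrite !inE.
have p0F : p0 \in freeBE s k a.+1 by rewrite freeBE_ee.
have boxp0 z : box U_(eb a)%MM (freeBE s k a.+1 :\ p0) z =
    box U_(eb a)%MM (freeBE s k a.+1) z && (z p0 == 0%N).
  apply/boxP/andP => [H|[/boxP H /eqP zp] x].
    split; last by have [_ ->] := H p0; rewrite ?setD11 // !mnm_edgeE.
    apply/boxP => x; have [h1 h2] := H x; split=> // xF; apply: h2.
    by rewrite p0E (negPf xF) andbF.
  have [h1 h2] := H x; split=> //; rewrite p0E negb_and negbK => /orP[/eqP->|//].
  by rewrite zp !mnm_edgeE.
have Pp0 : (U_(p0) <= U_(eb a) + Pm)%MM by rewrite lep1mP !mnm_edgeE /vx inordK.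
have boxp2 z : box (U_(eb a) + Pm - U_(p0))%MM (freeBE s k a.+1 :\ p0) z =
    [&& box U_(eb a)%MM (freeBE s k a.+1) z, z p0 == 0%N & Pdiv (z + U_(p0))%MM].
  rewrite andbA -boxp0.
  have p0e y : (ee y \in freeBE s k a.+1 :\ p0) = (y != vx s).
    by rewrite p0E freeBE_ee andbT eq_ee.
  apply/boxP/andP => [H|[/boxP H /forallP HP] x].
    split.
      apply/boxP => x; have := H x; case: (edgeP x) => y;
        rewrite mnmBE !mnm_edgeE ?subn0 // p0e negbK.
      move=> [_ h]; split=> // yx; rewrite h // eq_sym yx.
      by case: odd.
    apply/forallP => y; apply/implyP => oy; have [] := H (ee y).
    by rewrite mnmBE !mnm_edgeE oy; case: (vx s == y) => //=; lia.
  have := H x; case: (edgeP x) => y; rewrite mnmBE !mnm_edgeE ?subn0 // p0e negbK.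
  move=> [_ h]; split=> [|yx].
    by have := HP y; rewrite !mnm_edgeE; case: odd => /=; lia.
  by rewrite h // eq_sym yx; case: odd.
have nPp0 z : z p0 = 0%N -> ~~ Pdiv z.
  move=> zp; apply/negP => /forallP /(_ (vx s)).
  by rewrite zp ltnn /vx inordK.
apply: (exact_rank (rho := rho)) => // m.
have cv2 := convex_level (m := m) cv1 rho_mono.
have noA_free x T : x \in freeBE s k a.+1 :\ p0 -> noA a (x |: T) = noA a T.
  by rewrite p0E => /andP[_ xF]; apply: noAU1 => l; apply: ea_notin_free xF l.
have p0_free x T : x \in freeBE s k a.+1 :\ p0 -> (p0 \in x |: T) = (p0 \in T).
  by rewrite p0E => /andP[xp _]; rewrite !inE eq_sym (negPf xp).
case: m cv2 => [|[|[|m]]] cv2.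
- have Eq S : G3 S && (rho S == 0%N) = D S && ((noA a S && (p0 \notin S)) &&
      box U_(eb a)%MM (freeBE s k a.+1 :\ p0) (rep S)).
    rewrite G3E boxp0 /rho -!andbA; case: (D S) => //=; case: noA => //=.
    case: (p0 \in S) => /=; first by case: ifP; rewrite ?andbF.
    by case: (rep S p0 =P 0%N) => [zp|_]; [rewrite (nPp0 _ zp) !andbT|rewrite !andbF].
  apply: (exact_ext (fsym Eq)); apply: exact_free.
  + by move=> x T xF; rewrite noA_free // p0_free.
  + move=> S z z' /andP[NS _]; rewrite boxp0 => /andP[bz /eqP zp]; apply: (@QB_uniq a).
    by rewrite /QB NS bz (negPf (nPp0 _ zp)).
  + by rewrite mdeg1; lia.
  exact: convex_ext Eq cv2.
(* Moving p0 from S into the factor leaves the layer only if it makes P divide the factor, which is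
   the case set apart as rank 2. *)
- apply: (exact_toggle (e := p0)) => S eS.
  have [T xT ->] : exists2 T : {set 'I_q}, p0 \notin T & S = p0 |: T.
    by exists (S :\ p0); rewrite ?setD11 // setD1K.
  rewrite setU1K //.
  have nE : noA a (p0 |: T) = noA a T by apply: noAU1 => l; rewrite edge_eqE.
  apply/andP/andP => [[Gx rx]|[GT rT]].
    have := Gx; rewrite G3E => /andP[/fac_rep fx /andP[/andP[NS bx] nP]].
    have fT := fx; move/(facU1 _ xT): fT => fT.
    have nPT : ~~ Pdiv (rep (p0 |: T) + U_(p0))%MM.
      move: rx; rewrite /rho setU11 /=; case: (rep _ p0 =P 0%N) => [_|/eqP zp _] /=.
        by case: (Pdiv _).
      apply: contra nP => /forallP H; apply/forallP => y; have := H y.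
      rewrite mnmDE mnm1E; case: eqP => [<- _|_]; last by rewrite addn0.
      by rewrite lt0n zp implybT.
    rewrite nE in NS.
    have [GT rT] := G3_rep _ _ fT NS (boxD p0F bx) nPT.
    by rewrite GT /rho xT rT mnmDE mnm1E eqxx addn1 eqn0Ngt /= (negPf xT).
  have := GT; rewrite G3E => /andP[/fac_rep fT /andP[/andP[NS bT] nP]].
  have zp : (0 < rep T p0)%N by move: rT; rewrite /rho xT lt0n; case: (rep T p0 =P 0%N).
  have eT : (rep T - U_(p0) + U_(p0) = rep T)%MM by rewrite submK // lep1mP -lt0n.
  rewrite -eT in fT bT; move/(facU1 _ xT): fT => fx.
  have bx : box U_(eb a)%MM (freeBE s k a.+1) (rep T - U_(p0))%MM.
    by apply: (boxB p0F) bT; rewrite !mnm_edgeE.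
  rewrite -nE in NS.
  have nPx : ~~ Pdiv (rep T - U_(p0))%MM.
    by apply: contra nP => /(@PdivD _ U_(p0)%MM); rewrite eT.
  have [Gx rx] := G3_rep _ _ fx NS bx nPx.
  by rewrite Gx /rho setU11 /= rx eT (negPf nP) andbF.
- have Eq S : G3 S && (rho S == 2%N) = D S && ((noA a S && (p0 \in S)) &&
      box (U_(eb a) + Pm - U_(p0))%MM (freeBE s k a.+1 :\ p0) (rep S)).
    rewrite G3E boxp2 /rho -!andbA; case: (D S) => //=; case: noA => //=.
    case: (p0 \in S) => /=; last by case: ifP; rewrite ?andbF.
    case: box => //=; case: (rep S p0 =P 0%N) => [zp|_] /=; last by rewrite !andbF.
    rewrite (nPp0 _ zp).
    by case: (Pdiv _).
  apply: (exact_ext (fsym Eq)); apply: exact_free.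
  + by move=> x T xF; rewrite noA_free // p0_free.
  + move=> S z z' /andP[NS _]; rewrite boxp2 => /and3P[bz /eqP zp _]; apply: (@QB_uniq a).
    by rewrite /QB NS bz (negPf (nPp0 _ zp)).
  + by apply: (leq_trans (mdegB _ _)); rewrite mdegD mdeg1 mdeg_Pm; lia.
  exact: convex_ext Eq cv2.
by apply: exact_empty => S /andP[_]; rewrite /rho; do 2?case: ifP.
Qed.

Lemma exact_strand : exact_at K D i.
Proof.
have cv := @strand_convex _ _ G v.
apply: (exact_rank (rho := lam)) => // [T x|[|m]]; first exact: lam_mono.
  exact: exact_lam0 (convex_level cv lam_mono).
have cv1 := convex_level (m := m.+1) cv lam_mono.
have [mk|mk] := ltnP m k; last first.
  apply: exact_empty => S /andP[_ /eqP E]; exfalso.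
  have : (lam S <= k)%N by apply/bigmax_leqP => a _; apply: ltn_ord.
  by rewrite E; lia.
pose a : 'I_k := Ordinal mk.
have mono2 T x : D T && (lam T == m.+1) -> D (x |: T) && (lam (x |: T) == m.+1) ->
    (nat_of_bool (dva (x |: T) a) <= dva T a)%N.
  move=> /andP[DT _] /andP[Dx _]; case: (boolP (dva (x |: T) a)) => // h.
  by rewrite (dva_mono DT Dx h).
apply: (exact_rank (rho := fun S => nat_of_bool (dva S a))) => // -[|[|l]].
- have Eq := QBE a; apply: (exact_ext (fsym Eq)); apply: exact_QB.
  apply: (convex_ext Eq).
  exact: (convex_level (rho := fun S => nat_of_bool (dva S a)) cv1 mono2).
- exact: (@exact_dva a).
by apply: exact_empty => S /andP[_]; case: (dva S a).
Qed.

End Vanishing.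

Theorem theorem1p1 (K : closedFieldType) (charK : [pchar K] =i pred0)
  (r d : nat) (hr : (4 <= r)%N) (hrd : (r <= d)%N) :
  exists (n q : nat) (ends : 'I_q -> 'I_n * 'I_n),
    simple_graph ends /\ connected_graph ends /\
    regularity_is (@toric_ideal K n q ends) r /\
    exists h : {poly int},
      h_polynomial_is (@toric_ideal K n q ends) h /\ (size h).-1 = d.
Proof.
have [s rE] : exists s, r = s.+4 by exists (r - 4)%N; lia.
have [m dE] : exists m, d = (s.+4 + m)%N by exists (d - r)%N; lia.
exists (s.*2.+4.+2 + m.+1)%N, (m.+1 + m.+1 + s.*2.+4.+2)%N, (@bicycle s m.+1).
split; first exact: bicycle_simple.
split; first exact: bicycle_connected.
split.
  split; first by exists 1%N, s.+3.+2; split; [exact: betti_bicycle|rewrite rE; lia].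
  move=> i j b; rewrite leqNgt; apply/negP => ij.
  apply: (betti_strand (i := i) (j := j)) b => v dv.
  by apply: exact_strand dv _; lia.
exists (hpoly s m.+1); split; first exact: h_polynomial_bicycle.
by rewrite size_hpoly dE; lia.
Qed.
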